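(* For a locally compact Polish group $(G,\cdot)$ the following conditions are equivalent: (i) there exist a complete metric space $(X,d)$ and an effective continuous action $G \times X \ni (g,x) \mapsto g.x \in X$ such that $\operatorname{Iso}(X,d)$ consists precisely of all maps of the form $x \mapsto a.x$ $(a \in G)$ and $G.b$ is dense in $X$ for some $b \in X$; (ii) there exists a left invariant metric $\varrho \in \operatorname{Metr}_c(G)$ such that $\operatorname{Iso}(G,\varrho)$ consists precisely of all natural left translations of $G$ on itself (i.e. the maps $x \mapsto ax$, $a \in G$); in particular, $\operatorname{Iso}(G,\varrho)$ is isomorphic to $G$ and acts freely, transitively and properly on $G$; (iii) one of the following two conditions is fulfilled: (a) $G$ is Boolean, that is, $x^2 = e_G$ for each $x \in G$; (b) $G$ is non-Abelian and there is no open normal Abelian subgroup $H$ of $G$ of index $2$ such that $x^2 = p$ for any $x \in G \setminus H$, where $p \in H$ is independent of $x$ and such that $p^2 = e_G \neq p$. Moreover, condition (ii) is fulfilled in each of the following cases: $G$ is non-solvable; $G$ is non-Abelian and its center is either trivial or non-Boolean; $G$ is non-Abelian and connected.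
   Context: A topological space or group is Polish if it is separable and completely metrizable. A metric is proper if all closed balls with respect to it are compact. $\operatorname{Metr}_c(G)$ is the set of all proper metrics on $G$ which induce the topology of $G$. $\operatorname{Iso}(X,d)$ is the group of all bijective isometries of $(X,d)$, with the topology of pointwise convergence. $e_G$ is the neutral element of $G$. For an action of $G$ on $X$: $G.b = \{g.b : g \in G\}$; the action is effective if $g.x = x$ for all $x \in X$ implies $g = e_G$; free if $g.x = x$ for some $x \in X$ implies $g = e_G$; transitive if $G.x = X$ for some $x \in X$; proper if the map $G \times X \ni (g,x) \mapsto (x,g.x) \in X \times X$ is proper (preimages of compact sets are compact). A group $K$ is Boolean if $x^2 = e_K$ for all $x \in K$. *)

(* Defs.v *)
From HB Require Import structures.
From mathcomp Require Import all_boot all_order all_algebra.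
From mathcomp Require Import all_classical all_reals topology.
Set Implicit Arguments.
Unset Strict Implicit.
Unset Printing Implicit Defensive.

Import Order.TTheory GRing.Theory Num.Theory.
Import numFieldTopology.Exports.
Local Open Scope classical_set_scope.
Local Open Scope ring_scope.

(* A group with a topology, without any compatibility between the two. *)
#[short(type="preTopologicalGroupType")]
HB.structure Definition PreTopologicalGroup :=
  {G of Topological G & Group G}.

HB.mixin Record isTopologicalGroup G & PreTopologicalGroup G := {
  mulg_continuous : continuous (fun p : G * G => (p.1 * p.2)%g);
  invg_continuous : continuous (fun x : G => x^-1%g)
}.

#[short(type="topologicalGroupType")]
HB.structure Definition TopologicalGroup :=
  {G of PreTopologicalGroup G & isTopologicalGroup G}.

Section Metrics.
Context {R : realType}.

Definition is_metric {T : Type} (d : T -> T -> R) :=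
  [/\ forall x y, 0 <= d x y,
      forall x y, d x y = 0 <-> x = y,
      forall x y, d x y = d y x
    & forall x y z, d x z <= d x y + d y z].

Definition complete_metric {T : Type} (d : T -> T -> R) :=
  forall u : nat -> T,
    (forall e, 0 < e -> \forall m & n \near \oo, d (u m) (u n) < e) ->
    exists l, (fun n => d (u n) l) @ \oo --> (0 : R).

Definition induces_topology {T : topologicalType} (d : T -> T -> R) :=
  forall x : T,
    nbhs x = filter_from [set r : R | 0 < r] (fun r => [set y | d x y < r]).

(* Only used together with [induces_topology d], so that compactness in [T] is
   compactness with respect to [d]. *)
Definition proper_metric {T : topologicalType} (d : T -> T -> R) :=
  forall (x : T) (r : R), compact [set y | d x y <= r].

Definition Metr_c (T : topologicalType) : set (T -> T -> R) :=
  [set d | [/\ is_metric d, induces_topology d & proper_metric d]].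

Definition left_invariant {G : groupType} (d : G -> G -> R) :=
  forall g x y : G, d (g * x)%g (g * y)%g = d x y.

Definition separable_space (T : topologicalType) :=
  exists2 A : set T, countable A & dense A.

Definition completely_metrizable (T : topologicalType) :=
  exists d : T -> T -> R, [/\ is_metric d, induces_topology d & complete_metric d].

Definition polish_space (T : topologicalType) :=
  separable_space T /\ completely_metrizable T.

End Metrics.
Arguments Metr_c R T : clear implicits.
Arguments polish_space R T : clear implicits.

Section Isometries.
Context {R : realType} {X : topologicalType}.

Definition Iso (d : X -> X -> R) : set {ptws X -> X} :=
  [set f : X -> X | bijective f /\ forall x y, d (f x) (f y) = d x y].

(* [Iso d] as a group under composition, with the subspace topology inherited
   from the topology of pointwise convergence on [X -> X]. *)
Definition isom (d : X -> X -> R) : Type := set_type (Iso d).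

Variable d : X -> X -> R.

HB.instance Definition _ :=
  Topological.copy (isom d) (set_type (Iso d)).

Definition isom_fun (u : isom d) : X -> X := set_val u.

Lemma isom_funP (u : isom d) : Iso d (isom_fun u).
Proof. exact: set_valP. Qed.

Lemma isom_ext (u v : isom d) : isom_fun u =1 isom_fun v -> u = v.
Proof. by move=> uv; apply: val_inj; apply: funext. Qed.

Lemma Iso_id : Iso d id.
Proof. by split => //; exists id. Qed.

Lemma Iso_comp (f g : X -> X) : Iso d f -> Iso d g -> Iso d (f \o g).
Proof.
move=> [bf df] [bg dg]; split; first exact: bij_comp.
by move=> x y /=; rewrite df dg.
Qed.

Lemma Iso_inv (f : X -> X) :
  Iso d f -> exists g, [/\ Iso d g, cancel f g & cancel g f].
Proof.
move=> [[g fK gK] df]; exists g; split => //; split; first by exists f.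
by move=> x y; rewrite -df !gK.
Qed.

Definition isom_one : isom d := SigSub (mem_set Iso_id).

Definition isom_mul (u v : isom d) : isom d :=
  SigSub (mem_set (Iso_comp (isom_funP u) (isom_funP v))).

Lemma isom_inv_ex (u : isom d) :
  exists v : isom d, cancel (isom_fun u) (isom_fun v) /\
                     cancel (isom_fun v) (isom_fun u).
Proof.
have [g [Ig fK gK]] := Iso_inv (isom_funP u).
by exists (SigSub (mem_set Ig)).
Qed.

Definition isom_inv (u : isom d) : isom d := projT1 (cid (isom_inv_ex u)).

Lemma isom_mulA : associative isom_mul.
Proof. by move=> u v w; exact: isom_ext. Qed.

Lemma isom_mul1 : left_id isom_one isom_mul.
Proof. by move=> u; exact: isom_ext. Qed.

Lemma isom_mulr1 : right_id isom_one isom_mul.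
Proof. by move=> u; exact: isom_ext. Qed.

Lemma isom_mulV : left_inverse isom_one isom_inv isom_mul.
Proof.
move=> u; apply: isom_ext => x.
by have [uK _] := projT2 (cid (isom_inv_ex u)); exact: uK.
Qed.

Lemma isom_mulrV : right_inverse isom_one isom_inv isom_mul.
Proof.
move=> u; apply: isom_ext => x.
by have [_ uK] := projT2 (cid (isom_inv_ex u)); exact: uK.
Qed.

HB.instance Definition _ := isGroup.Build (isom d)
  isom_mulA isom_mul1 isom_mulr1 isom_mulV isom_mulrV.

End Isometries.

Definition topgroup_isomorphic (G H : preTopologicalGroupType) :=
  exists (f : G -> H) (g : H -> G),
    [/\ {morph f : x y / (x * y)%g}, cancel f g, cancel g f,
        continuous f & continuous g].

Section Actions.
Context {G : preTopologicalGroupType} {X : topologicalType}.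
Implicit Type act : G -> X -> X.

Definition continuous_action act :=
  [/\ forall x, act 1%g x = x,
      forall g h x, act (g * h)%g x = act g (act h x)
    & continuous (fun p : G * X => act p.1 p.2)].

Definition action_orbit act (b : X) : set X := range (fun g => act g b).

Definition effective_action act :=
  forall g, (forall x, act g x = x) -> g = 1%g.

Definition free_action act :=
  forall g, (exists x, act g x = x) -> g = 1%g.

Definition transitive_action act := exists x, action_orbit act x = [set: X].

Definition proper_action act :=
  forall K : set (X * X), compact K ->
    compact [set p : G * X | K (p.2, act p.1 p.2)].

End Actions.

Section GroupTheory.
Context {G : groupType}.
Implicit Type H : set G.

Definition Boolean H := forall x, H x -> (x ^+ 2 = 1)%g.

Definition is_abelian H := forall x y, H x -> H y -> (x * y = y * x)%g.

Definition subgroup H := group_closed (mem H).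

Definition normal_subgroup H :=
  subgroup H /\ forall x g, H x -> H (x ^ g)%g.

Definition left_cosets H : set (set G) := range (fun g => [set (g * h)%g | h in H]).

Definition has_index H (n : nat) := (left_cosets H #= `I_n)%card.

Definition group_center : set G := [set z | forall x, (z * x = x * z)%g].

Fixpoint derived_series (n : nat) : set G :=
  if n is m.+1 then
    smallest subgroup
      [set c | exists x y, [/\ derived_series m x, derived_series m y
                             & c = [~ x, y]%g]]
  else setT.

Definition is_solvable := exists n, derived_series n = [set 1%g].

End GroupTheory.
Arguments group_center G : clear implicits.
Arguments is_solvable G : clear implicits.

Section Conditions.
Context (R : realType) (G : topologicalGroupType).

Definition cond_i :=
  exists (X : metricType R) (act : G -> X -> X),
    [/\ complete_metric (@mdist R X), continuous_action act, effective_action act,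
        Iso (@mdist R X) = range act
      & exists b : X, dense (action_orbit act b)].

Definition left_translation_metric (rho : G -> G -> R) :=
  [/\ Metr_c R G rho, left_invariant rho
    & Iso rho = range (fun a x : G => (a * x)%g)].

Definition cond_ii := exists rho : G -> G -> R, left_translation_metric rho.

Definition exceptional_subgroup (H : set G) :=
  [/\ open H, normal_subgroup H, is_abelian H, has_index H 2
    & exists p : G, [/\ H p, (p ^+ 2 = 1)%g, p <> 1%g
                      & forall x, ~ H x -> (x ^+ 2 = p)%g]].

Definition cond_iii :=
  Boolean [set: G] \/
  (~ is_abelian [set: G] /\ ~ exists H : set G, exceptional_subgroup H).

End Conditions.

(* Main.v *)
Require Import Defs.
From HB Require Import structures.
From mathcomp Require Import all_boot all_order all_algebra.
From mathcomp Require Import all_classical all_reals topology.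
From mathcomp Require Import normedtype sequences ring lra.
Set Implicit Arguments.
Unset Strict Implicit.
Unset Printing Implicit Defensive.

(** An isometry of a left invariant metric that fixes the neutral element can
    only be controlled up to inversion, so the central notion is that of a sign
    map: [f 1 = 1] and [f x ^-1 * f y] is [x^-1 * y] or its inverse for all
    [x], [y].  A sign map of a non-Abelian group other than the identity moves
    some points, and comparing moved and fixed points produces an element [a]
    such that everything outside the centralizer of [a] inverts [a] and has one
    and the same square [p]; that centralizer is the exceptional subgroup.
    Hence under (iii) every sign map is trivial, and (ii) follows once there is
    a proper left invariant metric all of whose isometries fixing [1] satisfy
    [f x = x] or [f x = x^-1].

    Start from a proper length [p] (Struble), arranged so that conjugation by
    each member of a dense sequence [x_n] at most doubles [p] near [1].  If [G]
    is discrete, [p] is modified so that [p x] determines [x] up to inversion.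
    Otherwise [q := sqrt p] satisfies [q (x y) <= max + min / 2], which leaves
    room for [q + h] with [h] Lipschitz in [q] on both sides.  Away from [1] the
    slope of [sqrt p] with respect to [sqrt p] is zero, and [h] is a series, with
    weights [8^-(n+1)], of functions whose slope is positive exactly at [x_n] and
    [x_n^-1]; reading off slopes, isometries preserve [{x_n, x_n^-1}].

    For (i) => (iii), if (iii) fails there is a nontrivial involutive sign map
    [f]; the map [g.b |-> f(g).b] of the dense orbit is isometric, extends to [X]
    and hence is given by some [a] in [G], which contradicts effectiveness. *)

Import Order.TTheory GRing.Theory Num.Theory.
Import numFieldTopology.Exports numFieldNormedType.Exports.
Local Open Scope classical_set_scope.

(** * Sign maps and the exceptional subgroup *)

Section SignMaps.
Context {G : groupType}.
Implicit Types f : G -> G.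
Local Open Scope group_scope.

Lemma invg_sq1 (x : G) : x * x = 1 -> x^-1 = x.
Proof. by move=> xx; apply: mulg1_eq. Qed.

Lemma sq1_invg (x : G) : x^-1 = x -> x * x = 1.
Proof. by move=> {1}<-; rewrite mulVg. Qed.

Lemma conjg_id_commute (x y : G) : x ^ y = x -> x * y = y * x.
Proof. by move=> xy; rewrite conjgC xy. Qed.

Lemma conjg_idC (x y : G) : x ^ y = x -> y ^ x = y.
Proof. by move=> /conjg_id_commute xy; rewrite conjgE -xy mulKg. Qed.

Lemma commute_conjg_id (x y : G) : x * y = y * x -> x ^ y = x.
Proof. by move=> xy; rewrite conjgE xy mulKg. Qed.

Lemma conjgg (x : G) : x ^ x = x.
Proof. exact: commute_conjg_id. Qed.

Lemma conjg_inv_invol (x y : G) : x ^ y = x^-1 -> x ^ y = x -> x * x = 1.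
Proof. by move=> -> /sq1_invg. Qed.

Definition sign_map f :=
  f 1 = 1 /\ forall x y, (f x)^-1 * f y = x^-1 * y \/ (f x)^-1 * f y = y^-1 * x.

Section Rigidity.
Variables (f : G -> G) (signf : sign_map f).

Let f1 : f 1 = 1. Proof. by case: signf. Qed.

Lemma sign_map_val x : f x = x \/ f x = x^-1.
Proof. by have := signf.2 1 x; rewrite f1 !gsimp. Qed.

Lemma sign_mapM x z : f (x * z) = f x * z \/ f (x * z) = f x * z^-1.
Proof.
by case: (signf.2 x (x * z)) => h; [left|right]; apply: (mulgI (f x)^-1);
  rewrite mulKg h ?mulKg// invgM mulgVK.
Qed.

Let B y := f y <> y.

Let fB y : B y -> f y = y^-1.
Proof. by case: (sign_map_val y). Qed.

Let sqB y : B y -> y * y <> 1.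
Proof. by move=> By /invg_sq1 yy; apply: By; case: (sign_map_val y) => ->. Qed.

(** For a fixed [x] and a moved [y] the sign condition gives [x^-1 * y^-1 = x^-1 * y] or
    [x^-1 * y^-1 = y^-1 * x]. The first would make [y] an involution, which [f] cannot move. *)
Let moved_inverts x y : B y -> f x = x -> x ^ y = x^-1.
Proof.
move=> By fx; have := signf.2 x y; rewrite fx (fB By) => -[/mulgI|] h.
  by have := sqB By; move/sq1_invg: h.
by rewrite conjgE mulgA -h mulgVK.
Qed.

Let moved_cases0 x y : B y ->
  [\/ x ^ y = x, x ^ y = x^-1 | (y * y) * (x * x) = 1].
Proof.
move=> By; have e1 : f (y * x) = y^-1 * x \/ f (y * x) = y^-1 * x^-1.
  by rewrite -(fB By); exact: sign_mapM.
have [e2|e2] := sign_map_val (y * x); rewrite e2 in e1.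
  case: e1 => [/mulIg h|h]; first by case: (sqB By); apply: sq1_invg.
  by apply: Or33; rewrite mulgA -(mulgA y) h mulVKg mulVg.
rewrite invgM in e1; case: e1 => h.
  by apply: Or32; rewrite conjgE mulgA -h mulgVK.
apply: Or31; apply: invg_inj; rewrite -conjVg conjgE mulgA -h.
by rewrite mulgVK.
Qed.

(** The last case of [moved_cases0], used for both [x] and [x^-1], forces [x * x] and [y * y] to be
    the same involution or [1]. *)
Let moved_cases x y : B y ->
  [\/ x ^ y = x, x ^ y = x^-1 | y * y = x * x /\ (y * y) * (y * y) = 1].
Proof.
move=> By; have [||h] := moved_cases0 x By; [exact: Or31|exact: Or32|].
have [h'|h'|h'] := moved_cases0 x^-1 By.
- by apply: Or31; apply: invg_inj; rewrite -conjVg.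
- by apply: Or32; apply: invg_inj; rewrite -conjVg.
have yx : y * y = x * x.
  by apply: divg1_eq; rewrite invgM.
by apply: Or33; split=> //; rewrite {2}yx.
Qed.

Hypothesis nonab : ~ is_abelian [set: G].

Let noncommuting : exists x y : G, x ^ y <> x.
Proof.
apply: contrapT => h; apply: nonab => x y _ _; apply: conjg_id_commute.
by apply: contrapT => xy; apply: h; exists x, y.
Qed.

(** Otherwise [y] centralizes or inverts every element. If [y] is central, [f] is inversion, and for
    noncommuting [x], [z] the conjugate [(x * y) ^ z = x^-1 * y] must be [(x * y)^-1], so
    [y * y = 1]. If [y] inverts some [x] without fixing it, it also inverts [y * x], whence
    [x * x = (y * y)^-1]; this square is both fixed and inverted by [y]. *)
Let moved_order4 y : B y -> (y * y) * (y * y) = 1.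
Proof.
move=> By; apply: contrapT => y4.
have dich (x : G) : x ^ y = x \/ x ^ y = x^-1.
  by case: (moved_cases x By) => [||[_ /y4]//]; [left|right].
have [yZ|] := pselect (forall x, x ^ y = x).
  have fV x : f x = x^-1.
    case: (sign_map_val x) => // fx.
    by rewrite fx -{1}(yZ x); exact: moved_inverts.
  have dich2 (x z : G) : z ^ x = z \/ z ^ x = z^-1.
    case: (sign_mapM x z); rewrite !fV invgM => h; [right|left].
      by rewrite conjgE mulgA -h mulgVK.
    by apply: invg_inj; rewrite -conjVg conjgE mulgA -h mulgVK.
  have [x [z xz]] := noncommuting.
  have xzV : x ^ z = x^-1 by case: (dich2 z x).
  have : (x * y) ^ z = (x * y)^-1.
    case: (dich2 z (x * y)) => //; rewrite conjMg.
    by rewrite (conjg_idC (yZ z)) => /mulIg.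
  rewrite conjMg (conjg_idC (yZ z)) xzV invgM (conjg_id_commute (yZ x^-1)).
  by move=> /mulIg/esym/sq1_invg; exact: sqB.
move=> /existsNP[x xy]; have xyV : x ^ y = x^-1 by case: (dich x).
have h : (y * x) ^ y = (y * x)^-1.
  case: (dich (y * x)) => //; rewrite conjMg conjgg xyV => /mulgI h.
  by case: xy; rewrite xyV.
have xxE : x * x = (y * y)^-1.
  have e : x * y = y * x^-1 by rewrite -xyV; exact: conjgC.
  move: h; rewrite conjMg conjgg xyV -e invgM => h.
  by apply: divg1_eq; rewrite invgK -mulgA (mulgA x y) h mulgVK mulgV.
have xx : (x * x) ^ y = x * x by rewrite xxE conjVg conjMg conjgg.
have x4 : (x * x) * (x * x) = 1.
  by apply: sq1_invg; rewrite -[RHS]xx conjMg xyV invgM.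
by case: y4; rewrite -[y * y]invgK -xxE -invgM x4 invg1.
Qed.

Let moved2_cases y z : B y -> B z -> z ^ y = z \/ y * y = z * z.
Proof.
move=> By Bz; have := signf.2 y z; rewrite !(fB By, fB Bz) invgK => -[h|h].
  right; apply: (mulgI y^-1); apply: (mulIg z^-1).
  by rewrite mulKg h -mulgA mulgK.
left; apply: invg_inj; rewrite -conjVg.
exact: commute_conjg_id (esym h).
Qed.

(** If the squares differ, [y] and [z] commute and [y * z] is moved too. A fixed [x] would be
    inverted by [y], [z] and [y * z], hence commute with [y]; a moved [x] is excluded by comparing
    its square with those of [y], [z] and [y * z]. *)
Let moved_sq_unique y z x : B y -> B z -> x ^ y <> x -> z * z = y * y.
Proof.
move=> By Bz xy; apply: contrapT => zy.
have yz : y * z = z * y.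
  by case: (moved2_cases Bz By) => [/conjg_id_commute//|/zy].
have yyzz : (y * y) * (z * z) <> 1.
  move=> /mulg1_eq h; apply: zy; rewrite -h; apply: mulg1_eq.
  exact: moved_order4.
have yz2 : (y * z) * (y * z) = (y * y) * (z * z).
  by rewrite -mulgA (mulgA z) -yz !mulgA.
have Byz : B (y * z).
  move=> e; have := sign_mapM y z; rewrite e (fB By).
  move=> [/mulIg/esym/sq1_invg/(sqB By)//|h]; apply: yyzz.
  by rewrite -yz2 {1}h yz mulgA mulgVK mulVg.
have fxE : f x = x -> False.
  move=> fx; have xyV := moved_inverts By fx.
  apply: xy; rewrite xyV -(moved_inverts Byz fx) conjgM xyV conjVg.
  by rewrite (moved_inverts Bz fx) invgK.
have [|xyE] := moved2_cases By fxE; first exact: xy.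
have [xz|xz] := moved2_cases Bz fxE; last by apply: zy; rewrite xz xyE.
have [|h] := moved2_cases Byz fxE; first by rewrite yz conjgM xz.
move: h; rewrite yz2 -xyE -[RHS]mulg1 => /mulgI.
exact: sqB.
Qed.

(** If all moved elements were central, every noncentral element would be fixed by [f], hence
    inverted by the central [y], hence of square [1]. Applied to a noncentral [x] and to [x * y],
    this gives [y * y = 1]. *)
Let moved_noncentral y : B y -> exists z x, B z /\ x ^ z <> x.
Proof.
move=> By; apply: contrapT => h.
have BZ z x : B z -> x ^ z = x.
  by move=> Bz; apply: contrapT => xz; apply: h; exists z, x.
have [x [w xw]] := noncommuting.
have fx z v : z ^ v <> z -> f z = z.
  by move=> zv; apply: contrapT => /(@BZ _ v)/conjg_idC.
have Ay z : f z = z -> z * z = 1.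
  by move=> fz; apply: conjg_inv_invol (moved_inverts By fz) (BZ _ _ By).
have /Ay : f (x * y) = x * y.
  by apply: (fx _ w); rewrite conjMg (conjg_idC (BZ _ w By)) => /mulIg.
rewrite -mulgA (mulgA y) (conjg_id_commute (conjg_idC (BZ _ x By))).
rewrite -mulgA mulgA (Ay x) ?mul1g; last exact: fx xw.
exact: sqB.
Qed.

(* The centralizer of [a] is the exceptional subgroup. *)
Lemma sign_map_moved y : f y <> y -> exists a p g0 : G,
  [/\ p * p = 1, p <> 1, a ^ g0 <> a
    & forall g, a ^ g = a \/ a ^ g = a^-1 /\ g * g = p].
Proof.
move=> By0; have {y By0} [y [x [By xy]]] := moved_noncentral By0.
pose p := y * y.
have Bp z : B z -> z * z = p by move=> Bz; exact: moved_sq_unique By Bz xy.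
have pp : p * p = 1 by exact: moved_order4.
have p1 : p <> 1 by exact: sqB.
(* A fixed element that is not an involution serves as [a], with [g0 := y]. If there is none, fixed
   elements equal their inverses and the moved noncentral [y] itself serves. *)
have [[a fa aa]|A2] := pselect (exists2 a, f a = a & a * a <> 1).
  have ay := moved_inverts By fa.
  exists a, p, y; split=> //; first by rewrite ay => /sq1_invg.
  move=> g; have [fg|Bg] := pselect (f g = g); last first.
    by right; split; [exact: moved_inverts|exact: Bp].
  have [|ag] := pselect (a ^ g = a); [by left|right].
  (* If [a * g] were fixed, [y] would invert it along with [a] and [g], so [a] and [g] would
     commute. *)
  have Bag : B (a * g).
    move=> /(moved_inverts By); rewrite conjMg ay (moved_inverts By fg) -invgM.
    by move=> /invg_inj/esym/commute_conjg_id.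
  have agV : a ^ g = a^-1.
    by rewrite -(moved_inverts Bag fa) conjgM conjgg.
  split=> //; have e : a * g = g * a^-1 by rewrite -agV; exact: conjgC.
  by rewrite -(Bp _ Bag) {1}e -mulgA mulKg.
have {}A2 a : f a = a -> a * a = 1.
  by move=> fa; apply: contrapT => aa; apply: A2; exists a.
exists y, p, x; split=> //; first by move=> /conjg_idC.
move=> g; have [|yg] := pselect (y ^ g = y); [by left|right].
have gy : g ^ y <> g by move=> /conjg_idC.
have Bg : B g.
  by move=> fg; apply: gy; rewrite (moved_inverts By fg) invg_sq1 ?A2.
have Bgy : B (g * y).
  move=> fgy; apply: gy; apply: (mulIg y).
  have := moved_inverts By fgy; rewrite conjMg conjgg => ->.
  by rewrite invg_sq1 ?A2.
split; last exact: Bp.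
have gyg : g * y * g = y by apply: (mulIg y); rewrite -mulgA (Bp _ Bgy).
have ygE : y * g = g^-1 * y by rewrite -{2}gyg -mulgA mulKg.
rewrite conjgE ygE mulgA -invgM (Bp g Bg).
by apply: invg_inj; rewrite invgM !invgK /p mulKg.
Qed.

End Rigidity.
End SignMaps.

(** * Subgroups of index two *)

Section Subgroups.
Context {G : groupType}.
Implicit Type H : set G.
Local Open Scope group_scope.

Lemma subgroupP H :
  subgroup H <-> H 1 /\ forall x y, H x -> H y -> H (x / y).
Proof.
have memE x : (x \in mem H) = (x \in H) by [].
split=> -[H1 Hd]; split; rewrite ?memE ?inE// in H1 *.
- by move=> x y Hx Hy; have := Hd x y; rewrite !memE !inE; apply.
- by move=> x y; rewrite !memE !inE; exact: Hd.
Qed.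

Lemma subgroupV H x : subgroup H -> H x -> H x^-1.
Proof. by move=> /subgroupP[H1 Hd] Hx; rewrite -div1g; exact: Hd. Qed.

Lemma subgroupM H x y : subgroup H -> H x -> H y -> H (x * y).
Proof.
move=> sH Hx Hy; rewrite -[y]invgK.
by have /subgroupP[_] := sH; apply => //; exact: subgroupV.
Qed.

Lemma has_index2P H : subgroup H ->
  has_index H 2 <-> (exists g, ~ H g) /\
    (forall x y, ~ H x -> ~ H y -> H (x^-1 * y)).
Proof.
move=> sH; have /subgroupP[H1 Hd] := sH.
pose c (g : G) : set G := [set g * h | h in H].
have cE g x : c g x = H (g^-1 * x).
  apply/propext; split=> [[h Hh <-]|Hgx]; first by rewrite mulKg.
  by exists (g^-1 * x); rewrite ?mulVKg.
have ceq x y : H (x^-1 * y) -> c x = c y.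
  move=> Hxy; apply/seteqP; split=> z; rewrite !cE => Hz.
    by have := Hd _ _ (subgroupV sH Hxy) (subgroupV sH Hz);
       rewrite !invgM !invgK mulgA mulgK.
  by have := subgroupM sH Hxy Hz; rewrite mulgA mulgK.
split=> [/card_set_bijP[f [fI finj fsurj]]|[[g Hg] Hxy]].
  (* Pigeonhole: three cosets share two labels. *)
  have c2 x y z : [\/ c x = c y, c x = c z | c y = c z].
    have fb (v : G) : f (c v) = 0%N \/ f (c v) = 1%N.
      have : (f (c v) < 2)%N by apply: fI; exists v.
      by case: (f (c v)) => [|[|]]//; [left|right].
    have eq (v w : G) : f (c v) = f (c w) -> c v = c w.
      by apply: finj; rewrite inE; [exists v|exists w].
    case: (fb x) (fb y) (fb z) => ex [] ey [] ez;
      by [apply: Or31; apply: eq; rewrite ex ey|apply: Or32; apply: eq; rewrite ex ez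
         |apply: Or33; apply: eq; rewrite ey ez].
  split.
    have [C [x _ <-] fx] := fsurj 0%N isT.
    have [D [y _ <-] fy] := fsurj 1%N isT.
    have cxy : c x <> c y by move=> e; move: fx fy; rewrite -/(c x) -/(c y) e => ->.
    apply: contrapT => /forallNP hH; have {}hH g : H g by exact: contrapT (hH g).
    exact: cxy (ceq _ _ (hH _)).
  move=> x y Hx Hy; rewrite -cE.
  have mem z : c z z by rewrite cE mulVg.
  have neq z : ~ H z -> c z <> c 1.
    by move=> Hz e; apply: Hz; have := mem z; rewrite e cE invg1 mul1g.
  case: (c2 x y 1) => [->//|/(neq _ Hx)//|/(neq _ Hy)//].
(* The only coset containing [1] is [H], which therefore gets the label [0]. *)
apply/card_set_bijP; exists (fun C : set G => if `[< C 1 >] then 0%N else 1%N).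
split.
- by move=> C _ /=; case: asboolP.
- move=> C D; rewrite !inE => -[x _ <-] [y _ <-].
  rewrite -/(c x) -/(c y) !cE !mulg1.
  have VH z : H z^-1 -> H z by move/(subgroupV sH); rewrite invgK.
  case: asboolP => Hx; case: asboolP => Hy // _; apply: ceq.
    by apply: subgroupM => //; exact: VH.
  by apply: Hxy => h; [apply: Hx|apply: Hy]; exact: subgroupV.
- case=> [|[|//]] _.
    exists (c 1); first by exists 1.
    by rewrite asboolT // cE mulg1 invg1.
  exists (c g); first by exists g.
  rewrite asboolF// cE mulg1 => h; apply: Hg.
  by rewrite -[g]invgK; exact: subgroupV.
Qed.

End Subgroups.

Section Centralizer.
Context {G : groupType}.
Local Open Scope group_scope.
Variables (a p g0 : G).
Hypotheses (p2 : p * p = 1) (ag0 : a ^ g0 <> a).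
Hypothesis dich : forall g, a ^ g = a \/ a ^ g = a^-1 /\ g * g = p.

Let C : set G := [set x | a ^ x = a].

Let dichC g : ~ C g -> a ^ g = a^-1 /\ g * g = p.
Proof. by case: (dich g). Qed.

Let CV x : C x -> C x^-1.
Proof. by move=> Cx; rewrite /C/= -{1}Cx conjgK. Qed.

Let CM x y : C x -> C y -> C (x * y).
Proof. by move=> Cx Cy; rewrite /C/= conjgM Cx. Qed.

Lemma centralizer_subgroup : subgroup C.
Proof.
apply/subgroupP; split; first exact: conjg1.
by move=> x y Cx /CV; exact: CM.
Qed.

Lemma centralizer_normal : normal_subgroup C.
Proof.
split; first exact: centralizer_subgroup.
move=> x g Cx; have [Cg|/dichC[ag _]] := pselect (C g).
  by rewrite conjgE; apply: CM; [exact: CV|exact: CM].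
have agV : a ^ g^-1 = a^-1.
  by apply: (conjg_inj g); rewrite conjgKV conjVg ag invgK.
by rewrite /C/= (conjgE x g) !conjgM agV conjVg Cx conjVg ag invgK.
Qed.

Lemma centralizer_index : has_index C 2.
Proof.
apply/(has_index2P centralizer_subgroup); split; first by exists g0.
move=> x y /dichC[ax _] /dichC[ay _]; rewrite /C/= conjgM.
have -> : a ^ x^-1 = a^-1.
  by apply: (conjg_inj x); rewrite conjgKV conjVg ax invgK.
by rewrite conjVg ay invgK.
Qed.

(** Both [g0] and every element outside [C] invert [a]. This later turns closedness of the
    centralizer into openness. *)
Lemma centralizer_compl x : C x <-> ~ C (g0 * x).
Proof.
have [ag _] := dichC ag0; rewrite /C/= conjgM ag conjVg.
split=> [->|h]; first by rewrite -ag.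
by apply: contrapT => /dichC[ax _]; apply: h; rewrite ax invgK.
Qed.

(** For [h] in [C], both [g0] and [g0 * h] have square [p], so [g0] inverts [h]. Inversion is thus a
    homomorphism on [C]. *)
Lemma centralizer_abelian : is_abelian C.
Proof.
have [_ g0p] := dichC ag0.
have inv h : C h -> h ^ g0 = h^-1.
  move=> /centralizer_compl/dichC[_ ghp].
  have ghg : g0 = h * (g0 * h).
    by apply: (mulgI g0); rewrite g0p -ghp -!mulgA.
  by rewrite conjgE; apply: (mulIg h); rewrite -!mulgA -ghg !mulVg.
move=> x y Cx Cy; apply: invg_inj.
by rewrite -(inv (x * y) (CM Cx Cy)) conjMg !inv// invgM.
Qed.

Lemma centralizer_exp : C p /\ forall x, ~ C x -> x * x = p.
Proof.
split=> [|x /dichC[]//]; have [ag gp] := dichC ag0.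
by rewrite /C/= -gp conjgM ag conjVg ag invgK.
Qed.

End Centralizer.

Section TopologicalGroups.
Context {G : topologicalGroupType}.
Local Open Scope group_scope.

Lemma cvg_mulg {T} (F : set_system T) {FF : Filter F} (u v : T -> G) (a b : G) :
  u @ F --> a -> v @ F --> b -> (u x * v x) @[x --> F] --> a * b.
Proof.
move=> ua vb.
exact: (cvg_comp _ (fun p : G * G => p.1 * p.2) (cvg_pair ua vb)
  (mulg_continuous (a, b))).
Qed.

Lemma cvg_invg {T} (F : set_system T) {FF : Filter F} (u : T -> G) (a : G) :
  u @ F --> a -> (u x)^-1 @[x --> F] --> a^-1.
Proof. move=> ua; exact: (cvg_comp _ _ ua (invg_continuous a)). Qed.

Lemma mulgl_continuous (a : G) : continuous (fun x : G => a * x).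
Proof. by move=> x; apply: cvg_mulg; [exact: cvg_cst|exact: cvg_id]. Qed.

Lemma nbhs_mulgl (a x : G) U : nbhs (a * x) U -> nbhs x [set y | U (a * y)].
Proof. exact: mulgl_continuous. Qed.

Lemma conjg_continuous (a : G) : continuous (fun x : G => a ^ x).
Proof.
move=> x; apply: cvg_mulg; first by apply: cvg_invg; exact: cvg_id.
exact: mulgl_continuous.
Qed.

Lemma sign_map_exceptional (f : G -> G) :
  hausdorff_space G -> ~ is_abelian [set: G] -> sign_map f ->
  (exists y, f y <> y) -> exists H : set G, exceptional_subgroup H.
Proof.
move=> hG nab sf [y fy].
have [a [p [g0 [p2 p1 ag0 dich]]]] := sign_map_moved sf nab fy.
exists [set x | a ^ x = a].
have cl : closed [set x | a ^ x = a].
  apply: (@preimage_closed _ _ (fun x => a ^ x) [set a]) => [x _|].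
    exact: conjg_continuous.
  by apply: accessible_closed_set1; exact: hausdorff_accessible.
split.
- have -> : [set x | a ^ x = a] = (fun x => g0 * x) @^-1` ~` [set x | a ^ x = a].
    apply/seteqP; split=> x; first exact: (centralizer_compl ag0 dich x).1.
    exact: (centralizer_compl ag0 dich x).2.
  apply: open_comp; first by move=> x _; exact: mulgl_continuous.
  exact: closed_openC.
- exact: centralizer_normal dich.
- exact: (@centralizer_abelian _ _ p g0).
- exact: (@centralizer_index _ _ p g0).
- have [Cp h] := centralizer_exp ag0 dich.
  by exists p; split.
Qed.

End TopologicalGroups.

(** * Structure of a group with an exceptional subgroup *)

Section ExceptionalAlgebra.
Context {G : groupType}.
Local Open Scope group_scope.
Variables (H : set G) (p : G).
Hypotheses (nH : normal_subgroup H) (abH : is_abelian H) (iH : has_index H 2).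
Hypotheses (Hp : H p) (p2 : p * p = 1) (Hsq : forall x, ~ H x -> x * x = p).

Let sH : subgroup H. Proof. by case: nH. Qed.

Let HV x : H x -> H x^-1. Proof. exact: subgroupV. Qed.

Let HM x y : H x -> H y -> H (x * y). Proof. exact: subgroupM. Qed.

Let outV x : ~ H x -> x^-1 = p * x.
Proof.
by move=> /Hsq xp; apply: mulg1_eq; rewrite -xp -mulgA (mulgA x x (x * x)) xp.
Qed.

Let out_mul x y : ~ H x -> ~ H y -> H (x^-1 * y).
Proof. by have [_ h] := (has_index2P sH).1 iH; exact: h. Qed.

Let outM x y : H x -> ~ H y -> ~ H (x * y).
Proof.
by move=> Hx Hy Hxy; apply: Hy; rewrite -(mulKg x y); apply: HM => //; exact: HV.
Qed.

Let inoutM x y : ~ H x -> H y -> ~ H (x * y).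
Proof.
by move=> Hx Hy Hxy; apply: Hx; rewrite -(mulgK y x); apply: HM => //; exact: HV.
Qed.

Lemma exceptional_central x : p * x = x * p.
Proof.
have [Hx|Hx] := pselect (H x); first exact: abH.
by rewrite -(Hsq Hx) mulgA.
Qed.

Lemma exceptional_inverts x h : ~ H x -> H h -> h ^ x = h^-1.
Proof.
move=> Hx Hh; have := Hsq (inoutM Hx Hh); rewrite -(Hsq Hx) -!mulgA.
move=> /mulgI e; rewrite conjgE; apply: (mulIg h).
by rewrite -!mulgA e !mulVg.
Qed.

Definition exceptional_flip x := if `[< H x >] then x else x^-1.

(** Outside [H] inversion is multiplication by the central involution [p]. If both or neither of
    [x], [y] lie in [H], the factors [p] cancel; otherwise one remains, and it inverts [x^-1 * y],
    which lies outside [H]. *)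
Lemma exceptional_flip_sign : sign_map exceptional_flip.
Proof.
have H1 : H 1 by case: ((subgroupP H).1 sH).
have pV x y : p * x * (p * y) = x * y.
  by rewrite exceptional_central -!mulgA (mulgA p) p2 mul1g.
rewrite /exceptional_flip; split; first by case: asboolP; rewrite ?invg1.
move=> x y; case: asboolP => Hx; case: asboolP => Hy; first by left.
- right; have := outV (outM (HV Hx) Hy); rewrite invgM invgK => ->.
  by rewrite (outV Hy) !mulgA exceptional_central.
- right; rewrite invgK; have Hxi : ~ H x^-1 by move=> /HV; rewrite invgK.
  have := outV (inoutM Hxi Hy); rewrite invgM invgK => ->.
  by rewrite mulgA -(outV Hxi) invgK.
- left; rewrite invgK (outV Hx) (outV Hy) mulgA.
  by rewrite exceptional_central.
Qed.

Lemma exceptional_flipK : involutive exceptional_flip.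
Proof.
move=> x; rewrite /exceptional_flip.
have [Hx|Hx] := pselect (H x); first by rewrite !(asboolT Hx).
have HxV : ~ H x^-1 by move=> /HV; rewrite invgK.
by rewrite (asboolF Hx) (asboolF HxV) invgK.
Qed.

(** [H] has index two, so it contains all commutators; being abelian, it makes the second derived
    group trivial. *)
Lemma exceptional_solvable : is_solvable G.
Proof.
have commH x y : H [~ x, y].
  have [Hx|Hx] := pselect (H x).
    by rewrite commgEl; apply: HM; [exact: HV|case: nH => _; exact].
  have [Hy|Hy] := pselect (H y).
    by rewrite commgEr; apply: HM => //; case: nH => _; apply; exact: HV.
  have xV z : ~ H z -> ~ H z^-1 by move=> Hz /HV; rewrite invgK.
  rewrite /commg conjgE mulgA; apply: HM.
    by apply: out_mul => //; exact: xV.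
  by rewrite -{1}[x]invgK; apply: out_mul => //; exact: xV.
have D1H : derived_series 1 `<=` H.
  by apply: smallest_sub => // c [x [y [_ _ ->]]].
have s1 : subgroup [set 1 : G].
  by apply/subgroupP; split=> // x y -> ->; rewrite mulgV.
exists 2; apply/seteqP; split.
  apply: smallest_sub => // c [x [y [/D1H Hx /D1H Hy ->]]].
  by apply/eqP/commgP; exact: abH.
by move=> _ -> K [/subgroupP[]].
Qed.

(** A central [z] outside [H] both fixes and inverts [H], so every outside element commutes with
    [H]; as [H] and [z] generate [G], it is abelian. A central element of [H] is inverted by outside
    elements, so its square is [1]. *)
Lemma exceptional_center : Boolean (group_center G) \/ is_abelian [set: G].
Proof.
have [[z zZ Hz]|ZH] := pselect (exists2 z, group_center G z & ~ H z).
  right; have conjz (x : G) : x ^ z = x by apply: commute_conjg_id; rewrite zZ.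
  have HZ h x : H h -> h * x = x * h.
    move=> Hh; have [Hx|Hx] := pselect (H x); first exact: abH.
    apply: conjg_id_commute.
    by rewrite (exceptional_inverts Hx Hh) -(exceptional_inverts Hz Hh).
  move=> x y _ _; have [Hx|Hx] := pselect (H x); first exact: HZ.
  have zy : z^-1 * y = y * z^-1 by apply: invg_inj; rewrite !invgM invgK zZ.
  by apply: (mulgI z^-1); rewrite !mulgA (HZ _ y (out_mul Hz Hx)) mulgA -zy.
left=> z zZ; have [g Hg] := ((has_index2P sH).1 iH).1.
have Hz : H z by apply: contrapT => Hz; apply: ZH; exists z.
rewrite expg2; apply: sq1_invg.
by rewrite -(exceptional_inverts Hg Hz); apply: commute_conjg_id.
Qed.

End ExceptionalAlgebra.

Section ExceptionalConsequences.
Context {G : topologicalGroupType}.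
Implicit Types H : set G.
Local Open Scope group_scope.

Lemma abelian_solvable : is_abelian [set: G] -> is_solvable G.
Proof.
move=> ab; exists 1%N; apply/seteqP; split.
  apply: smallest_sub => [|c [x [y [_ _ ->]]]].
    by apply/subgroupP; split=> // x y -> ->; rewrite mulgV.
  by apply/eqP/commgP; exact: ab.
by move=> _ -> K [/subgroupP[]].
Qed.

Lemma nonsolvable_cond_iii : ~ is_solvable G -> cond_iii G.
Proof.
move=> nsol; right; split; first by move=> /abelian_solvable.
move=> [H [_ nH abH iH [p [Hp p2 _ Hsq]]]]; apply: nsol.
exact: exceptional_solvable nH abH iH.
Qed.

Lemma center_cond_iii : ~ is_abelian [set: G] ->
  group_center G = [set 1] \/ ~ Boolean (group_center G) -> cond_iii G.
Proof.
move=> nab hZ; right; split=> // -[H [_ nH abH iH [p [Hp p2 p1 Hsq]]]].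
case: hZ => [Z1|nB].
  apply: p1; have : group_center G p; last by rewrite Z1.
  exact: exceptional_central abH Hp Hsq.
by case: (exceptional_center nH abH iH Hsq).
Qed.

Lemma connected_cond_iii :
  ~ is_abelian [set: G] -> connected [set: G] -> cond_iii G.
Proof.
move=> nab cG; right; split=> // -[H [oH [sH _] _ iH _]].
have [[g Hg] Hxy] := (has_index2P sH).1 iH.
have [H1 _] := (subgroupP H).1 sH.
suff HT : H = [set: G] by apply: Hg; rewrite HT.
apply: cG; [by exists 1|by exists H; rewrite ?setTI|exists H; rewrite ?setTI//].
(* Translation by [g] outside [H] exchanges [H] with its closed complement, so [H] is clopen. *)
suff -> : H = (fun x => g * x) @^-1` ~` H.
  apply: preimage_closed; first by move=> x _; exact: mulgl_continuous.
  exact: open_closedC.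
apply/seteqP; split=> x /= Hx.
  by move=> Hgx; apply: Hg; rewrite -(mulgK x g); apply: subgroupM => //; exact: subgroupV.
by have := Hxy _ _ Hg Hx; rewrite mulKg.
Qed.

(** The two ways to fail: [G] is abelian but not Boolean, and [f] is inversion; or there is an
    exceptional subgroup, and [f] is its flip, which moves every outside element because
    [p <> 1]. *)
Lemma not_cond_iii : ~ cond_iii G -> exists f : G -> G,
  [/\ sign_map f, involutive f, exists g, f g <> g &
    is_abelian [set: G] /\ (forall x, f x = x^-1) \/
    exists (H : set G) (p : G), [/\ exists g, ~ H g, p <> 1, p * p = 1,
      forall x, p * x = x * p &
      forall x, ~ H x -> [/\ x * x = p, f x = x^-1 & forall y, H y -> y ^ x = y^-1]]].
Proof.
move=> niii.
have nB : ~ Boolean [set: G] by move=> B; apply: niii; left.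
have [ab|nab] := pselect (is_abelian [set: G]).
  exists (fun x => x^-1); split; last by left.
  - split; first exact: invg1.
    by move=> x y; right; rewrite invgK; exact: ab.
  - exact: invgK.
  - apply: contrapT => /forallNP h; apply: nB => x _; rewrite expg2.
    by apply: sq1_invg; exact: contrapT (h x).
have [H eH] : exists H : set G, exceptional_subgroup H.
  by apply: contrapT => h; apply: niii; right.
have [_ nH abH iH [p [Hp p2 p1 Hsq]]] := eH.
exists (exceptional_flip H); split.
- exact: exceptional_flip_sign nH abH Hp p2 Hsq.
- by exact: exceptional_flipK nH.
- have [[g Hg] _] := (has_index2P nH.1).1 iH.
  exists g; rewrite /exceptional_flip asboolF// => /sq1_invg.
  by have := Hsq _ Hg; rewrite expg2 => ->.
- right; exists H, p; split=> //.
  + by case: ((has_index2P nH.1).1 iH).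
  + exact: exceptional_central abH Hp Hsq.
  + move=> x Hx; split; [exact: Hsq|by rewrite /exceptional_flip asboolF|].
    by move=> y; exact: (exceptional_inverts nH Hsq).
Qed.

End ExceptionalConsequences.

Local Open Scope ring_scope.

(** * A proper left invariant length *)

Section MetricTopology.
Context {R : realType} {T : topologicalType} (d : T -> T -> R).
Hypotheses (dm : is_metric d) (dT : induces_topology d).

Lemma metric_distxx x : d x x = 0.
Proof. by case: dm => _ h _ _; exact/h. Qed.

Lemma metric_dist_gt0 x y : x <> y -> 0 < d x y.
Proof.
case: dm => ge0 h _ _ xy; rewrite lt_neqAle ge0 andbT eq_sym.
by apply/eqP => /h.
Qed.

Lemma metric_nbhs_ball x (e : R) : 0 < e -> nbhs x [set y | d x y < e].
Proof. by move=> e0; rewrite dT; exists e. Qed.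

Lemma metric_hausdorff_space : hausdorff_space T.
Proof.
case: dm => ge0 eq0 sym tri x y xy; apply: contrapT => xNy.
have r0 : 0 < d x y / 2 by rewrite divr_gt0// metric_dist_gt0.
have [z []] := xy _ _ (metric_nbhs_ball x r0) (metric_nbhs_ball y r0).
rewrite /= (sym y) => xz zy; have := tri x z y.
by rewrite leNgt [d x y]splitr ltrD.
Qed.

End MetricTopology.

Lemma separable_range (T : topologicalType) (x0 : T) :
  separable_space T -> exists u : nat -> T, dense (range u).
Proof.
move=> [A /countable_injP[f finj] dA].
exists (fun n => xget x0 [set x | A x /\ f x = n]) => O O0 oO.
have [z [Oz Az]] := dA O O0 oO; exists z; split=> //; exists (f z) => //.
case: xgetP => [y _ /= [Ay fyz]|/(_ z)]; last by case.
by apply: finj => //; rewrite inE.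
Qed.

(** * Two-sided chains of neighbourhoods of the neutral element *)

Section SmallNeighbourhoods.
Context {G : topologicalGroupType}.
Local Open Scope group_scope.

Lemma nbhs1_mul3 (U : set G) : nbhs 1 U -> exists2 V : set G, nbhs 1 V &
  forall x y z, V x -> V y -> V z -> U (x * y * z).
Proof.
move=> U1.
have c : (fun p : G * (G * G) => p.1 * p.2.1 * p.2.2) p @[p --> (1, (1, 1))] --> (1 : G).
  rewrite -[X in _ --> X](mulg1) -[X in _ --> X * _](mulg1).
  apply: cvg_mulg; first apply: cvg_mulg.
  - exact: cvg_fst.
  - by apply: (cvg_comp snd fst); [exact: cvg_snd|exact: cvg_fst].
  - by apply: (cvg_comp snd snd); [exact: cvg_snd|exact: cvg_snd].
have [[A B] /= [A1 [[B1 B2] /= [B11 B21] Bs]] AB] := c _ U1.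
exists (A `&` (B1 `&` B2)); first by do 2?apply: filterI.
move=> x y z [Ax _] [_ [B1y _]] [_ [_ B2z]].
by apply: (AB (x, (y, z))); split=> //; apply: Bs.
Qed.

Lemma nbhs1_conj (U : set G) (a : G) : nbhs 1 U -> nbhs 1 [set x | U (x ^ a)].
Proof.
move=> U1; have : (x ^ a) @[x --> (1 : G)] --> (1 : G).
  rewrite -{2}(conj1g a) conjgE; apply: cvg_mulg; first exact: cvg_cst.
  by apply: cvg_mulg; [exact: cvg_id|exact: cvg_cst].
by apply.
Qed.

Lemma nbhs1_inv (U : set G) : nbhs 1 U -> nbhs 1 [set x | U x^-1].
Proof.
move=> U1; have : (x^-1) @[x --> (1 : G)] --> (1 : G).
  by rewrite -{2}invg1; apply: cvg_invg; exact: cvg_id.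
by apply.
Qed.

(** One step of the shrinking chain. Only the conjugations by [xs 0], ..., [xs k] are controlled at
    step [k], a finite intersection of neighbourhoods; each [xs i] is thus controlled from some step
    on. *)
Lemma nbhs1_refine (xs : nat -> G) (k : nat) (U W : set G) :
  nbhs 1 U -> nbhs 1 W -> exists V : set G,
  [/\ nbhs 1 V, forall x, V x -> V x^-1,
      forall x y z, V x -> V y -> V z -> U (x * y * z), V `<=` W &
      forall i x, (i <= k)%N -> V x -> U (x ^ xs i) /\ U (x ^ (xs i)^-1)].
Proof.
move=> U1 W1; have [V V1 VU] := nbhs1_mul3 U1.
have K1 : nbhs 1 [set x | forall i, (i <= k)%N -> U (x ^ xs i) /\ U (x ^ (xs i)^-1)].
  elim: k => [|k IH].
    apply: filterS2 (nbhs1_conj (xs 0) U1) (nbhs1_conj (xs 0)^-1 U1).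
    by move=> x ? ? [].
  apply: filterS3 IH (nbhs1_conj (xs k.+1) U1) (nbhs1_conj (xs k.+1)^-1 U1).
  by move=> x h ? ? i; rewrite leq_eqVlt => /predU1P[->//|]; exact: h.
set K := (X in nbhs 1 X) in K1.
pose V0 := V `&` (W `&` K).
have V01 : nbhs 1 V0 by do 2?apply: filterI.
exists (V0 `&` [set x | V0 x^-1]); split.
- by apply: filterI => //; exact: nbhs1_inv.
- by move=> x [h1 h2]; split=> //=; rewrite invgK.
- by move=> x y z [[? _] _] [[? _] _] [[? _] _]; exact: VU.
- by move=> x [[_ []]].
- by move=> i x ik [[_ [_ Kx]] _]; exact: Kx.
Qed.

End SmallNeighbourhoods.

Section Chain.
Context {R : realType} {G : topologicalGroupType}.
Variables (d : G -> G -> R) (xs : nat -> G).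
Hypothesis dG : induces_topology d.
Hypotheses (lcG : locally_compact [set: G]) (dxs : dense (range xs)).
Local Open Scope group_scope.

Definition mul3 (A : set G) : set G :=
  [set z | exists x y w, [/\ A x, A y, A w & z = x * y * w]].

Lemma compact_mul3 A : compact A -> compact (mul3 A).
Proof.
move=> cA; have -> : mul3 A =
    (fun p : G * (G * G) => p.1 * p.2.1 * p.2.2) @` (A `*` (A `*` A)).
  apply/seteqP; split=> [_ [x [y [w [Ax Ay Aw ->]]]]|].
    by exists (x, (y, w)).
  by move=> _ [[x [y w]] /= [Ax [Ay Aw]] <-]; exists x, y, w.
apply: continuous_compact; last by do 2?apply: compact_setX.
apply: continuous_subspaceT => p; apply: cvg_mulg; first apply: cvg_mulg.
- exact: cvg_fst.
- by apply: (cvg_comp snd fst); [exact: cvg_snd|exact: cvg_fst].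
- by apply: (cvg_comp snd snd); [exact: cvg_snd|exact: cvg_snd].
Qed.

Lemma compact_invg (A : set G) : compact A -> compact [set x | A x^-1].
Proof.
move=> cA; have -> : [set x | A x^-1] = (fun x => x^-1) @` A.
  apply/seteqP; split=> [x Ax|_ [x Ax <-]]; last by rewrite /= invgK.
  by exists x^-1 => //; rewrite invgK.
apply: continuous_compact => //; apply: continuous_subspaceT.
exact: invg_continuous.
Qed.

Lemma compact_lmul (A : set G) g : compact A -> compact [set g * x | x in A].
Proof.
move=> cA; apply: continuous_compact => //; apply: continuous_subspaceT.
exact: mulgl_continuous.
Qed.

Lemma compact_symmetric_nbhs : exists K : set G,
  [/\ nbhs 1 K, compact K & forall x, K x -> K x^-1].
Proof.
have [K KT [cK _]] := @lcG 1 I.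
have {}KT : nbhs (1 : G) [set x | [set: G] x -> K x] := KT.
have K1 : nbhs 1 K by apply: filterS KT => x; exact.
exists (K `|` [set x | K x^-1]); split.
- by apply: filterS K1 => x; left.
- by apply: compactU => //; exact: compact_invg.
- by move=> x [Kx|Kx]; [right; rewrite /= invgK|left].
Qed.

Variables (K : set G).
Hypotheses (K1 : nbhs 1 K) (cK : compact K) (KV : forall x, K x -> K x^-1).

(** Adding the translates of [K] along the dense sequence makes the growing compact sets exhaust
    [G]; adding their inverses keeps the sets symmetric. *)
Definition grow_step k (W : set G) : set G :=
  W `|` ([set xs k * x | x in K] `|` [set z | [set xs k * x | x in K] z^-1]).

Fixpoint grow k : set G := if k is k'.+1 then mul3 (grow_step k' (grow k')) else K.

Lemma grow_compact k : compact (grow k).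
Proof.
elim: k => //= k IH; apply/compact_mul3/compactU => //; apply: compactU.
  exact: compact_lmul.
by apply: compact_invg; exact: compact_lmul.
Qed.

Lemma grow_mem1 k : grow k 1.
Proof.
elim: k => [|k IH] /=; first exact: nbhs_singleton.
by exists 1, 1, 1; split; rewrite ?mulg1//; left.
Qed.

Lemma grow_mul3 k x y z : grow k x -> grow k y -> grow k z -> grow k.+1 (x * y * z).
Proof. by move=> Wx Wy Wz; exists x, y, z; split=> //; left. Qed.

Lemma grow_invg k x : grow k x -> grow k x^-1.
Proof.
elim: k x => [x|k IH] /=; first exact: KV.
have sV z : grow_step k (grow k) z -> grow_step k (grow k) z^-1.
  case=> [/IH|[h|h]]; [by left|right; right|by right; left].
  by rewrite /= invgK.
move=> _ [x [y [w [/sV Wx /sV Wy /sV Ww ->]]]].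
by exists w^-1, y^-1, x^-1; split=> //; rewrite !invgM mulgA.
Qed.

Lemma grow_sub k l : (k <= l)%N -> grow k `<=` grow l.
Proof.
elim: l => [|l IH]; first by rewrite leqn0 => /eqP ->.
rewrite leq_eqVlt => /predU1P[->//|/IH kl x /kl Wx].
by rewrite -[x]mulg1 -[x * 1]mulg1; apply: grow_mul3 => //; exact: grow_mem1.
Qed.

Lemma grow_cover x : exists k, grow k x.
Proof.
have nx : nbhs x [set y | K (y^-1 * x)].
  have : (y^-1 * x) @[y --> x] --> (1 : G).
    rewrite -(mulVg x); apply: cvg_mulg; last exact: cvg_cst.
    by apply: cvg_invg; exact: cvg_id.
  by apply.
move: nx; rewrite nbhsE => -[O [oO Ox] OK].
have [y [/OK Kx [k _ yE]]] := dxs (ex_intro _ x Ox) oO; rewrite -yE in Kx.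
exists k.+1; exists (xs k * ((xs k)^-1 * x)), 1, 1; split.
- by right; left; exists ((xs k)^-1 * x).
- by left; exact: grow_mem1.
- by left; exact: grow_mem1.
- by rewrite !mulg1 mulVKg.
Qed.

Lemma shrink_ex : exists S : nat -> set G,
  [/\ S 0%N = K, forall k, nbhs 1 (S k), forall k x, S k x -> S k x^-1,
      forall k x y z, S k.+1 x -> S k.+1 y -> S k.+1 z -> S k (x * y * z) &
      (forall k, S k.+1 `<=` [set x | (d 1%g x < k.+1%:R^-1)%R]) /\
      (forall k i x, (i <= k)%N -> S k.+1 x ->
        S k (x ^ xs i) /\ S k (x ^ (xs i)^-1))].
Proof.
(* The guard [nbhs 1 U] makes the relation total, so that a choice function can be iterated. *)
pose P k (U V : set G) := nbhs 1 U ->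
  [/\ nbhs 1 V, forall x, V x -> V x^-1,
      forall x y z, V x -> V y -> V z -> U (x * y * z),
      V `<=` [set x | (d 1%g x < k.+1%:R^-1)%R] &
      forall i x, (i <= k)%N -> V x -> U (x ^ xs i) /\ U (x ^ (xs i)^-1)].
have ex (kU : nat * set G) : exists V, P kU.1 kU.2 V.
  have [U1|] := pselect (nbhs 1 kU.2); last by move=> h; exists setT.
  have b : nbhs 1 [set x | (d 1%g x < kU.1.+1%:R^-1)%R].
    by apply: metric_nbhs_ball => //; rewrite invr_gt0.
  by have [V hV] := nbhs1_refine xs kU.1 U1 b; exists V => _.
have [F hF] := choice ex.
pose S := fix S k := if k is k'.+1 then F (k', S k') else K.
have S1 k : nbhs 1 (S k).
  by elim: k => //= k IH; case: (hF (k, S k) IH).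
exists S; split=> //; try by move=> k; case: (hF (k, S k) (S1 k)).
  by case=> [|k]; [exact: KV|case: (hF (k, S k) (S1 k))].
by split=> k; case: (hF (k, S k) (S1 k)).
Qed.

End Chain.

Lemma nbhs_chain_ex (R : realType) (G : topologicalGroupType) (d : G -> G -> R)
    (xs : nat -> G) :
  induces_topology d -> locally_compact [set: G] -> dense (range xs) ->
  exists V : int -> set G,
  [/\ forall n, nbhs 1%g (V n), forall n x, V n x -> V n x^-1%g,
      forall n x y z, V n x -> V n y -> V n z -> V (n + 1) (x * y * z)%g &
  [/\ forall U, nbhs 1%g U -> exists n, V n `<=` U,
      forall x, exists n, V n x,
      forall n, exists2 C, compact C & V n `<=` C &
      forall i, exists N, forall n x, n <= N -> V n x ->
        V (n + 1) (x ^ xs i)%g /\ V (n + 1) (x ^ (xs i)^-1)%g]].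
Proof.
move=> dG lcG dxs; have [K [K1 cK KV]] := compact_symmetric_nbhs lcG.
have [S [S0 S1 SV S3 [Sd Sc]]] := shrink_ex xs dG K1 KV.
(* [Negz k] is [-(k+1)], so the two chains meet at [V 0 = K = S 0]. *)
pose V (n : int) := match n with Posz k => grow xs K k | Negz k => S k.+1 end.
have SK k : S k `<=` K.
  elim: k => [|k IH]; first by rewrite S0.
  apply: subset_trans IH => x Sx.
  by rewrite -[x]mulg1 -[(x * 1)%g]mulg1; apply: S3 => //; exact: nbhs_singleton.
have VN1 k : V (Negz k + 1) = S k.
  by case: k => [|k]; rewrite NegzE; [rewrite addNr S0|rewrite -[k.+2]addn1 PoszD opprD subrK].
have VP1 (k : nat) : V (k%:Z + 1) = grow xs K k.+1 by rewrite -PoszD addn1.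
exists V; split.
- case=> k /=; last exact: S1.
  by apply: (@filterS _ _ _ K _ _ K1) => x Kx; exact: (grow_sub K1 (leq0n k) Kx).
- by case=> k x /=; [exact: grow_invg|exact: SV].
- by case=> k x y z; [rewrite VP1; exact: grow_mul3|rewrite VN1; exact: S3].
split.
- move=> U; rewrite dG => -[r /= r0 rU].
  have [k kr] : exists k : nat, k.+1%:R^-1 < r.
    by exists (Num.truncn r^-1); rewrite invf_plt ?posrE// truncnS_gt.
  by exists (Negz k) => x /Sd /= h; apply: rU => /=; exact: lt_trans kr.
- by move=> x; have [k Wx] := grow_cover dxs K1 x; exists (Posz k).
- case=> k; first by exists (grow xs K k) => //; exact: grow_compact.
  by exists K => //; exact: SK.
(* At level [-(n+1)] the conjugations by [xs i] with [i <= n] are controlled. *)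
- move=> i; exists (Negz i) => -[n x|n x]; first by [].
  by rewrite VN1 => ni; apply: Sc.
Qed.

Definition length_fun {R : realType} {G : groupType} (l : G -> R) :=
  [/\ l 1%g = 0, forall x, 0 <= l x, forall x, l x^-1%g = l x
    & forall x y, l (x * y)%g <= l x + l y].

Definition chain_cost {R : realType} {G : groupType} (w : seq (int * G)) : R :=
  \sum_(a <- w) 2%:R ^ a.1.

Section ChainLength.
Context {R : realType} {G : groupType}.
Variable V : int -> set G.
Hypotheses (V1 : forall n, V n 1%g) (VV : forall n x, V n x -> V n x^-1%g).
Hypothesis V3 : forall n x y z, V n x -> V n y -> V n z -> V (n + 1) (x * y * z)%g.
Hypothesis Vcov : forall x, exists n, V n x.
Local Notation word := (seq (int * G)).
Implicit Types w : word.
Local Notation cost := (@chain_cost R G).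

Definition chain_value w : G := foldr (fun a x => (a.2 * x)%g) 1%g w.

Fixpoint chain_word w : Prop :=
  if w is a :: w' then V a.1 a.2 /\ chain_word w' else True.

(** The Birkhoff-Kakutani construction: the cheapest factorization of [x], where a factor in [V n]
    costs [2^n]. Levels of both signs make the length proper as well as compatible with the
    topology. *)
Definition chain_length (x : G) : R :=
  inf [set cost w | w in [set w | chain_word w /\ chain_value w = x]].

Lemma chain_cost_ge0 w : 0 <= cost w.
Proof. by apply: sumr_ge0 => a _; exact: exprz_ge0. Qed.

Lemma chain_cost_nil : cost [::] = 0.
Proof. exact: big_nil. Qed.

Lemma chain_cost_cons a w : cost (a :: w) = 2%:R ^ a.1 + cost w.
Proof. exact: big_cons. Qed.

Lemma chain_cost_cat w1 w2 : cost (w1 ++ w2) = cost w1 + cost w2.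
Proof. exact: big_cat. Qed.

Lemma chain_word_cat w1 w2 : chain_word (w1 ++ w2) <-> chain_word w1 /\ chain_word w2.
Proof. by elim: w1 => [|a w1 IH] /=; [tauto|rewrite IH; tauto]. Qed.

Lemma chain_value_cat w1 w2 :
  chain_value (w1 ++ w2) = (chain_value w1 * chain_value w2)%g.
Proof. by elim: w1 => [|a w1 IH] /=; rewrite ?mul1g// IH mulgA. Qed.

Lemma chain_sub m n : m <= n -> V m `<=` V n.
Proof.
have V_succ k : V k `<=` V (k + 1).
  by move=> x Vx; rewrite -[x]mulg1 -[(x * 1)%g]mulg1; exact: V3.
rewrite -subr_ge0 -{2}(subrK m n); case: (n - m) => // k _.
elim: k => [|k IH]; first by rewrite add0r.
by apply: subset_trans IH _; rewrite -addn1 PoszD addrAC; exact: V_succ.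
Qed.

Lemma chain_split w (t : R) : 0 < t -> t <= cost w -> exists w1 a w2,
  [/\ w = w1 ++ a :: w2, cost w1 <= t & cost w2 <= cost w - t].
Proof.
elim: w t => [t t0|b w IH t t0].
  by rewrite chain_cost_nil leNgt t0.
rewrite chain_cost_cons => tw; have [tb|bt] := leP t (2%:R ^ b.1).
  exists [::], b, w; split=> //; first by rewrite chain_cost_nil ltW.
  by rewrite lerBrDr addrC lerD2r.
have [||w1 [a [w2 [-> w1t w2t]]]] := IH (t - 2%:R ^ b.1).
- by rewrite subr_gt0.
- by rewrite lerBlDl.
exists (b :: w1), a, w2; split=> //; rewrite ?chain_cost_cons; lra.
Qed.

(* The word is cut at the letter where half of its cost is reached: both
   remaining parts have at most half of the cost. *)
Lemma chain_value_mem w (n : int) :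
  chain_word w -> cost w < 2%:R ^ n -> V n (chain_value w).
Proof.
have [m] := ubnP (size w); elim: m w n => // m IH w n wm ww wn.
have [w0|w0] := eqVneq w [::]; first by rewrite w0; exact: V1.
have c0 : 0 < cost w.
  case: w w0 {wm ww wn} => // a w _; rewrite chain_cost_cons.
  by apply: ltr_pwDl; [exact: exprz_gt0|exact: chain_cost_ge0].
have half : 2%:R ^ (n - 1) = 2%:R ^ n / 2 :> R.
  by rewrite expfzDr ?pnatr_eq0// exprN1.
have [||w1 [a [w2 [wE w1c w2c]]]] := @chain_split w (cost w / 2).
- by rewrite divr_gt0.
- lra.
move: ww; rewrite wE => /chain_word_cat[ww1 [Va ww2]].
have sz : (size w1 < m)%N /\ (size w2 < m)%N.
  move: wm; rewrite wE size_cat /= ltnS addnS => h.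
  by split; apply: leq_ltn_trans h; rewrite ?leq_addr ?leq_addl.
rewrite chain_value_cat /= mulgA -[n](subrK 1).
apply: V3; first by apply: IH => //; [exact: sz.1|rewrite half; lra].
  apply: (@chain_sub a.1) => //; rewrite -ltzD1 subrK.
  rewrite -(ltr_eXz2l (_ : 1 < 2%:R :> R)) ?ltr1n//; apply: le_lt_trans wn.
  rewrite wE chain_cost_cat chain_cost_cons.
  by have := chain_cost_ge0 w1; have := chain_cost_ge0 w2; lra.
by apply: IH => //; [exact: sz.2|rewrite half; lra].
Qed.

Let costs x : set R := [set cost w | w in [set w | chain_word w /\ chain_value w = x]].

Let costs_lb x : lbound (costs x) 0.
Proof. by move=> _ [w _ <-]; exact: chain_cost_ge0. Qed.

Let costs_n0 x : costs x !=set0.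
Proof.
have [n Vx] := Vcov x; exists (cost [:: (n, x)]), [:: (n, x)] => //=.
by rewrite mulg1.
Qed.

Lemma chain_length_le x w : chain_word w -> chain_value w = x -> chain_length x <= cost w.
Proof. by move=> ww wx; apply: ge_inf; [exists 0; exact: costs_lb|exists w]. Qed.

Lemma chain_length_lt x (e : R) : chain_length x < e ->
  exists w, [/\ chain_word w, chain_value w = x & cost w < e].
Proof.
by move=> /(inf_lt (costs_n0 x))[_ [w [ww wx] <-] we]; exists w.
Qed.

Lemma chain_length_ge x (c : R) :
  (forall w, chain_word w -> chain_value w = x -> c <= cost w) -> c <= chain_length x.
Proof.
by move=> h; apply: lb_le_inf; [exact: costs_n0|move=> _ [w [ww wx] <-]; exact: h].
Qed.

Lemma chain_lengthM_inv w : chain_word w ->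
  exists w', [/\ chain_word w', chain_value w' = (chain_value w)^-1%g & cost w' = cost w].
Proof.
elim: w => [_|a w IH /= [Va /IH[w' [ww' vw' cw']]]].
  by exists [::]; split=> //=; rewrite invg1.
exists (w' ++ [:: (a.1, a.2^-1%g)]); split.
- by apply/chain_word_cat; split=> //=; split=> //; exact: VV.
- by rewrite chain_value_cat vw' /= mulg1 invgM.
- by rewrite chain_cost_cat !chain_cost_cons /= chain_cost_nil addr0 addrC cw'.
Qed.

Lemma chain_length_fun : length_fun chain_length.
Proof.
have ge0 x : 0 <= chain_length x.
  by apply: chain_length_ge => w _ _; exact: chain_cost_ge0.
have leV x : chain_length x^-1%g <= chain_length x.
  apply: chain_length_ge => w ww wx; have [w' [ww' vw' <-]] := chain_lengthM_inv ww.
  by apply: chain_length_le => //; rewrite vw' wx.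
split=> //.
- apply/eqP; rewrite eq_le ge0 andbT.
  have -> : 0 = cost [::] by rewrite chain_cost_nil.
  exact: chain_length_le.
- move=> x; apply/eqP; rewrite eq_le leV /=.
  by rewrite -{1}[x]invgK.
- move=> x y; apply/ler_addgt0Pr => e e0.
  have e2 : 0 < e / 2 by rewrite divr_gt0.
  have [|w1 [ww1 <- c1]] := @chain_length_lt x (chain_length x + e / 2).
    by rewrite ltrDl.
  have [|w2 [ww2 <- c2]] := @chain_length_lt y (chain_length y + e / 2).
    by rewrite ltrDl.
  apply: (@le_trans _ _ (cost (w1 ++ w2))); last by rewrite chain_cost_cat; lra.
  by apply: chain_length_le; [exact/chain_word_cat|exact: chain_value_cat].
Qed.

Lemma chain_length_mem x n : chain_length x < 2%:R ^ n -> V n x.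
Proof. by move=> /chain_length_lt[w [ww <- wn]]; exact: chain_value_mem. Qed.

Lemma mem_chain_length x n : V n x -> chain_length x <= 2%:R ^ n.
Proof.
move=> Vx; have -> : 2%:R ^ n = cost [:: (n, x)].
  by rewrite chain_cost_cons chain_cost_nil addr0.
by apply: chain_length_le => //=; rewrite mulg1.
Qed.

(** Since the total cost is below [2^n0], every letter has level at most [n0], where conjugation
    raises levels by one and so doubles costs. *)
Lemma chain_word_conj (a : G) (n0 : int) w :
  (forall n x, n <= n0 -> V n x -> V (n + 1) (x ^ a)%g) ->
  chain_word w -> cost w < 2%:R ^ n0 ->
  exists w', [/\ chain_word w', chain_value w' = (chain_value w ^ a)%g
               & cost w' = 2%:R * cost w].
Proof.
move=> Va; elim: w => [_ _|b w IH /= [Vb ww]].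
  by exists [::]; split=> //=; rewrite ?conj1g// chain_cost_nil mulr0.
rewrite chain_cost_cons => c.
have bn : b.1 <= n0.
  rewrite -(ler_eXz2l (_ : 1 < 2%:R :> R)) ?ltr1n//.
  by have := chain_cost_ge0 w; lra.
have [||w' [ww' vw' cw']] := IH => //.
  by apply: le_lt_trans c; rewrite lerDr exprz_ge0.
exists ((b.1 + 1, (b.2 ^ a)%g) :: w'); split=> /=.
- by split=> //; exact: Va.
- by rewrite vw' conjMg.
- by rewrite !chain_cost_cons /= cw' expfzDr ?pnatr_eq0// expr1z; ring.
Qed.

Lemma chain_length_conj (a : G) (n0 : int) :
  (forall n x, n <= n0 -> V n x -> V (n + 1) (x ^ a)%g) ->
  forall x, chain_length x < 2%:R ^ n0 -> chain_length (x ^ a)%g <= 2%:R * chain_length x.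
Proof.
move=> Va x xn; apply/ler_addgt0Pr => e e0.
have [|w [ww wx wc]] := @chain_length_lt x (Num.min (2%:R ^ n0) (chain_length x + e / 2)).
  by rewrite lt_min xn ltrDl divr_gt0.
move: wc; rewrite lt_min => /andP[wn wc].
have [w' [ww' vw' cw']] := chain_word_conj Va ww wn.
apply: (@le_trans _ _ (cost w')); first by apply: chain_length_le; rewrite ?vw' ?wx.
rewrite cw'; lra.
Qed.

End ChainLength.

(** Balls need only lie in a compact set; their closedness is supplied later by the metric. *)
Definition proper_length {R : realType} {G : topologicalGroupType} (l : G -> R) :=
  [/\ length_fun l,
      forall U, nbhs 1%g U <-> exists2 r, 0 < r & [set x | l x < r] `<=` U
    & forall r, exists2 C, compact C & [set x | l x <= r] `<=` C].

Definition length_dist {R : realType} {G : groupType} (l : G -> R) (x y : G) : R :=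
  l (x^-1 * y)%g.

Section LengthFunctions.
Context {R : realType} {G : groupType} (l : G -> R) (ll : length_fun l).

Lemma length1 : l 1%g = 0. Proof. by case: ll. Qed.

Lemma length_ge0 x : 0 <= l x. Proof. by case: ll. Qed.

Lemma lengthV x : l x^-1%g = l x. Proof. by case: ll. Qed.

Lemma lengthM x y : l (x * y)%g <= l x + l y. Proof. by case: ll. Qed.

Lemma lengthM_sub x y : `|l (x * y)%g - l x| <= l y.
Proof.
have h1 := lengthM x y; have h2 := lengthM (x * y)%g y^-1%g.
by rewrite mulgK lengthV in h2; rewrite ler_norml; lra.
Qed.

Lemma lengthC x y : l (x^-1 * y)%g = l (y^-1 * x)%g.
Proof. by rewrite -lengthV invgM invgK. Qed.

Lemma length_dist_left_invariant : left_invariant (length_dist l).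
Proof. by move=> g x y; rewrite /length_dist invgM mulgA mulgVK. Qed.

End LengthFunctions.

Lemma metric_closed_ball (R : realType) (T : topologicalType) (d : T -> T -> R) :
  is_metric d -> induces_topology d -> forall x r, closed [set y | d x y <= r].
Proof.
move=> [ge0 eq0 sym tri] dT x r; rewrite -[X in closed X]setCK.
apply: open_closedC; rewrite openE => y /= /negP; rewrite -ltNge => ry.
rewrite /interior dT; exists (d x y - r); first by rewrite /= subr_gt0.
move=> z /= yz; apply/negP; rewrite -ltNge.
by have := tri x z y; rewrite (sym z y); lra.
Qed.

Lemma proper_length_Metr_c (R : realType) (G : topologicalGroupType) (l : G -> R) :
  hausdorff_space G -> proper_length l -> Metr_c R G (length_dist l).
Proof.
move=> hG [ll nb pr]; have dm : is_metric (length_dist l).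
  split=> [x y|x y|x y|x y z].
  - exact: (length_ge0 ll).
  - rewrite /length_dist; split=> [l0|->]; last by rewrite mulVg (length1 ll).
    apply: contrapT => xy.
    have /nb[r r0] : nbhs 1%g (~` [set x^-1 * y]%g).
      apply: open_nbhs_nbhs; split.
        by apply/closed_openC/accessible_closed_set1/hausdorff_accessible.
      by move=> /= /esym/mulg1_eq; rewrite invgK.
    by move=> /(_ (x^-1 * y)%g); rewrite /= l0 => /(_ r0); apply.
  - exact: (lengthC ll).
  - have := lengthM ll (x^-1 * y)%g (y^-1 * z)%g.
    by rewrite mulgA mulgK.
have dG : induces_topology (length_dist l).
  move=> x; apply/seteqP; split=> [U xU|U [r r0 rU]].
    have /nb[r r0 h] : nbhs 1%g [set y | U (x * y)%g].
      by apply: nbhs_mulgl; rewrite mulg1.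
    by exists r => // y /h /=; rewrite mulVKg.
  have b : nbhs 1%g [set y | l y < r] by apply/nb; exists r.
  have {}b : nbhs x [set y | l (x^-1 * y)%g < r].
    by apply: (nbhs_mulgl (U := [set y | l y < r])); rewrite mulVg.
  by apply: filterS b => y; exact: rU.
split=> // x r; have [C cC sC] := pr r.
apply: (@subclosed_compact _ _ [set (x * y)%g | y in C]).
- exact: metric_closed_ball.
- exact: compact_lmul.
- by move=> y /= /sC Cy; exists (x^-1 * y)%g => //; rewrite mulVKg.
Qed.

Lemma proper_length_ex (R : realType) (G : topologicalGroupType) (d : G -> G -> R)
    (xs : nat -> G) :
  induces_topology d -> locally_compact [set: G] -> dense (range xs) ->
  exists2 p : G -> R, proper_length p &
    forall i, exists2 e, 0 < e & forall x, p x < e ->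
      p (x ^ xs i)%g <= 2 * p x /\ p (x ^ (xs i)^-1)%g <= 2 * p x.
Proof.
move=> dG lcG dxs.
have [V [V1 VV V3 [Vb Vc VC Vconj]]] := nbhs_chain_ex dG lcG dxs.
have V1' n : V n 1%g by exact: nbhs_singleton.
have e2 k : (k.+1%:R < 2%:R ^ (k.+1%:Z) :> R).
  by rewrite -exprnP -natrX ltr_nat; exact: ltn_expl.
pose p : G -> R := chain_length V; exists p.
  split.
  - exact: chain_length_fun.
  - move=> U; split=> [/Vb[n VU]|[r r0 rU]].
      exists (2%:R ^ n); first exact: exprz_gt0.
      by move=> x /= h; apply: VU; exact: chain_length_mem h.
    pose k := Num.truncn r^-1.
    apply: filterS (V1 (- k.+1%:Z)) => x /(mem_chain_length (R := R)) h.
    apply: rU => /=; apply: le_lt_trans h _.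
    rewrite -invr_expz invf_plt ?posrE ?exprz_gt0//.
    exact: lt_trans (truncnS_gt _) (e2 k).
  - move=> r; pose k := Num.truncn r; have [C cC VC'] := VC k.+1%:Z.
    exists C => // x /= h; apply: VC'; apply: (@chain_length_mem R) => //.
    apply: le_lt_trans h _; exact: lt_trans (truncnS_gt _) (e2 k).
move=> i; have [N hN] := Vconj i; exists (2%:R ^ N); first exact: exprz_gt0.
move=> x px; split.
  by apply: chain_length_conj px => // n y nN Vy; have [] := hN n y nN Vy.
by apply: chain_length_conj px => // n y nN Vy; have [] := hN n y nN Vy.
Qed.

(** * Lengths determining their elements up to inversion *)

Lemma length_dist_fix1 (R : realType) (G : groupType) (l : G -> R) (f : G -> G) :
  (forall x y, length_dist l (f x) (f y) = length_dist l x y) -> f 1%g = 1%g ->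
  forall x, l (f x) = l x.
Proof. by move=> fl f1 x; have := fl 1%g x; rewrite /length_dist f1 invg1 !mul1g. Qed.

Lemma int_frac_le (R : realType) (m n : int) (s t : R) :
  0 < s -> t < 1 -> m%:~R + s <= n%:~R + t -> m <= n.
Proof. by move=> s0 t1 h; rewrite -ltzD1 -(ltr_int R) intrD mulr1z; lra. Qed.

(** * Discrete groups *)

Section DiscreteLength.
Context {R : realType} {G : topologicalGroupType}.
Variables (p : G -> R) (xs : nat -> G).
Hypotheses (pp : proper_length p) (dxs : dense (range xs)).
Hypothesis disc : nbhs (1%g : G) [set 1%g].

Let lp : length_fun p. Proof. by case: pp. Qed.

Let xs_or_inv x n := (x == xs n) || (x == (xs n)^-1%g).

Let enumerated x : exists n, xs_or_inv x n.
Proof.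
have : nbhs x [set y | [set 1%g] (x^-1 * y)%g].
  by apply: nbhs_mulgl; rewrite mulVg.
rewrite nbhsE => -[O [oO Ox] Os].
have [y [/Os /mulg1_eq yx [n _ ny]]] := dxs (ex_intro _ x Ox) oO.
by exists n; rewrite /xs_or_inv ny -yx invgK eqxx.
Qed.

Let idx x := ex_minn (enumerated x).

Let idxV x : idx x^-1%g = idx x.
Proof.
have e n : xs_or_inv x^-1%g n = xs_or_inv x n.
  by rewrite /xs_or_inv eqg_invLR eqg_inv orbC.
rewrite /idx; case: ex_minnP => m Pm mmin; case: ex_minnP => n Pn nmin.
by apply/eqP; rewrite eqn_leq mmin ?e// nmin// -e.
Qed.

Let idx_inj x y : idx x = idx y -> y = x \/ y = x^-1%g.
Proof.
rewrite /idx; case: ex_minnP => m Pm _; case: ex_minnP => n Pn _ mn.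
move: Pn Pm; rewrite -mn /xs_or_inv => /orP[] /eqP -> /orP[] /eqP ->;
  rewrite ?invgK; tauto.
Qed.

Let frac (n : nat) : R := n.+2%:R^-1.

Let frac_bounds n : 0 < frac n /\ frac n < 1.
Proof. by rewrite /frac invr_gt0 invf_lt1 ?ltr0n// ltr1n. Qed.

(** The integer part retains [p], up to a bounded error, and the fractional part, in the open unit
    interval, records the least index of [x] or [x^-1] in the sequence. The summand [1] pays for the
    fractional part in the triangle inequality. *)
Definition discrete_length x : R :=
  if x == 1%g then 0 else (Num.ceil (p x) + 1)%:~R + frac (idx x).

Let ge_p x : p x <= discrete_length x.
Proof.
rewrite /discrete_length; case: eqP => [->|_]; first by rewrite (length1 lp).
have := ceil_ge (p x); have [h1 h2] := frac_bounds (idx x).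
by rewrite intrD mulr1z; lra.
Qed.

Let ge1 x : x <> 1%g -> 1 <= discrete_length x.
Proof.
move=> /eqP/negbTE x1; rewrite /discrete_length x1.
have := ceil_ge (p x); have := length_ge0 lp x.
by have [h1 h2] := frac_bounds (idx x); rewrite intrD mulr1z; lra.
Qed.

Lemma discrete_length_proper : proper_length discrete_length.
Proof.
have [_ nb pr] := pp.
have l1 : discrete_length 1%g = 0 by rewrite /discrete_length eqxx.
have ge0 x : 0 <= discrete_length x := le_trans (length_ge0 lp x) (ge_p x).
split.
- split=> // [x|x y].
    by rewrite /discrete_length invg_eq1 (lengthV lp) idxV.
  have [->|x1] := eqVneq x 1%g; first by rewrite mul1g l1 add0r.
  have [->|y1] := eqVneq y 1%g; first by rewrite mulg1 l1 addr0.
  have [->|xy1] := eqVneq (x * y)%g 1%g; first by rewrite l1 addr_ge0.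
  rewrite /discrete_length (negbTE x1) (negbTE y1) (negbTE xy1).
  have [_ h1] := frac_bounds (idx (x * y)%g); have [h2 _] := frac_bounds (idx x).
  have [h3 _] := frac_bounds (idx y).
  have c : (Num.ceil (p (x * y)%g) <= Num.ceil (p x) + Num.ceil (p y))%R.
    rewrite ceil_le_int intrD; apply: le_trans (lengthM lp x y) _.
    by apply: lerD; exact: ceil_ge.
  by move: c; rewrite -(ler_int R) !intrD !mulr1z; lra.
- move=> U; split=> [/nbhs_singleton U1|[r r0 rU]].
    exists 1 => // x /= lx; suff -> : x = 1%g by [].
    by apply: contrapT => /ge1; rewrite leNgt lx.
  by apply: filterS disc => _ ->; apply: rU; rewrite /= l1.
- by move=> r; have [C cC pC] := pr r; exists C => // x /= /(le_trans (ge_p x)); exact: pC.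
Qed.

Lemma discrete_length_inj x y : discrete_length x = discrete_length y ->
  y = x \/ y = x^-1%g.
Proof.
have [->|/eqP x1] := eqVneq x 1%g.
  rewrite {1}/discrete_length eqxx => l0; left; apply: contrapT => /ge1.
  by rewrite -l0 ler10.
have [->|/eqP y1] := eqVneq y 1%g.
  rewrite {2}/discrete_length eqxx => l0; have := ge1 x1.
  by rewrite l0 ler10.
move/eqP/negbTE: x1 => x1; move/eqP/negbTE: y1 => y1.
rewrite /discrete_length x1 y1 => e; apply: idx_inj.
have [h1 h2] := frac_bounds (idx x); have [h3 h4] := frac_bounds (idx y).
have ce : Num.ceil (p x) + 1 = Num.ceil (p y) + 1.
  apply/eqP; rewrite eq_le; apply/andP; split.
    by apply: (int_frac_le h1 h4); rewrite e.
  by apply: (int_frac_le h3 h2); rewrite e.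
move: e; rewrite ce => /addrI/invr_inj/eqP; rewrite eqr_nat => /eqP.
by case.
Qed.

End DiscreteLength.

(** * Nondiscrete groups: square roots and slopes *)

Section SqrtDifferences.
Context {R : rcfType}.
Implicit Types u v t : R.

Lemma sqrtrD_le u v : 0 <= u -> 0 <= v -> Num.sqrt (u + v) <= Num.sqrt u + Num.sqrt v.
Proof.
move=> u0 v0; rewrite -[leRHS]ger0_norm ?addr_ge0 ?sqrtr_ge0// -sqrtr_sqr.
rewrite ler_wsqrtr// sqrrD !sqr_sqrtr//.
have : 0 <= Num.sqrt u * Num.sqrt v by rewrite mulr_ge0 ?sqrtr_ge0.
lra.
Qed.

Lemma sqrt_dist_le u v t : 0 <= u -> 0 <= v -> `|v - u| <= t ->
  `|Num.sqrt v - Num.sqrt u| <= Num.sqrt t.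
Proof.
move=> u0 v0 uvt; have t0 : 0 <= t := le_trans (normr_ge0 _) uvt.
move: uvt; rewrite !ler_norml => /andP[h1 h2]; apply/andP; split.
  rewrite lerNl opprB lerBlDl; apply: le_trans (sqrtrD_le v0 t0).
  by apply: ler_wsqrtr; lra.
rewrite lerBlDl; apply: le_trans (sqrtrD_le u0 t0).
by apply: ler_wsqrtr; lra.
Qed.

(** Away from [0] the square root is Lipschitz, by factoring [v - u] as a difference of squares.
    This is the source of zero slopes. *)
Lemma sqrt_dist_flat u v t : 0 < u -> 0 <= v -> `|v - u| <= t ->
  `|Num.sqrt v - Num.sqrt u| <= (Num.sqrt u)^-1 * t.
Proof.
move=> u0 v0 uvt; have su : 0 < Num.sqrt u by rewrite sqrtr_gt0.
have sv : 0 <= Num.sqrt v by exact: sqrtr_ge0.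
rewrite ler_pdivlMl//; apply: le_trans uvt.
have -> : v - u = (Num.sqrt v - Num.sqrt u) * (Num.sqrt v + Num.sqrt u).
  by rewrite -subr_sqr !sqr_sqrtr// ltW.
rewrite normrM mulrC.
by rewrite ler_wpM2l// ger0_norm ?lerDr ?addr_ge0// ltW.
Qed.

End SqrtDifferences.

Section SubadditiveLengths.
Context {R : realType} {G : topologicalGroupType} (p : G -> R).
Hypothesis lp : length_fun p.

(* The distance of [x] from [{s, s^-1}] for the largest pseudometric
   [D] with [D x (x * y) <= p y] and [D x (y * x) <= p y]. *)
Definition biinv_dist (s x : G) : R :=
  inf [set r | exists a b, (x = a * s * b \/ x = a * s^-1 * b)%g /\ r = p a + p b].

Variable s : G.
Local Notation D := (biinv_dist s).

Let costs_lb x :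
  lbound [set r | exists a b, (x = a * s * b \/ x = a * s^-1 * b)%g /\ r = p a + p b] 0.
Proof. by move=> _ [a [b [_ ->]]]; rewrite addr_ge0 ?(length_ge0 lp). Qed.

Lemma biinv_dist_le x a b : (x = a * s * b \/ x = a * s^-1 * b)%g -> D x <= p a + p b.
Proof. by move=> h; apply: ge_inf; [exists 0; exact: costs_lb|exists a, b]. Qed.

Lemma biinv_dist_ge x (c : R) :
  (forall a b, (x = a * s * b \/ x = a * s^-1 * b)%g -> c <= p a + p b) -> c <= D x.
Proof.
move=> h; apply: lb_le_inf; last by move=> _ [a [b [/h ? ->]]].
exists (p 1%g + p (s^-1 * x)%g), 1%g, (s^-1 * x)%g; split=> //; left.
by rewrite mul1g mulVKg.
Qed.

Lemma biinv_dist_ge0 x : 0 <= D x.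
Proof. by apply: biinv_dist_ge => a b _; rewrite addr_ge0 ?(length_ge0 lp). Qed.

Lemma biinv_distV x : D x^-1%g = D x.
Proof.
have le z : D z^-1%g <= D z.
  apply: biinv_dist_ge => a b zE; rewrite addrC -(lengthV lp a) -(lengthV lp b).
  apply: biinv_dist_le; case: zE => ->; [right|left];
  by rewrite !invgM ?invgK mulgA.
by apply/eqP; rewrite eq_le le -{1}[x]invgK le.
Qed.

Lemma biinv_distM x y : `|D (x * y)%g - D x| <= p y.
Proof.
have le z w : D (z * w)%g <= D z + p w.
  rewrite -lerBlDr; apply: biinv_dist_ge => a b zE; rewrite lerBlDr -addrA.
  apply: (@le_trans _ _ (p a + p (b * w)%g)); last by rewrite lerD2l (lengthM lp).
  by apply: biinv_dist_le; case: zE => ->; [left|right]; rewrite !mulgA.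
rewrite ler_norml; apply/andP; split; last by rewrite lerBlDl le.
by rewrite lerNl opprB lerBlDl; have := le (x * y)%g y^-1%g; rewrite mulgK (lengthV lp).
Qed.

Lemma biinv_dist_self x : x = s \/ x = s^-1%g -> D x = 0.
Proof.
move=> xs; apply/eqP; rewrite eq_le biinv_dist_ge0 andbT.
rewrite -[leRHS]addr0 -{1}(length1 lp) -(length1 lp).
by apply: biinv_dist_le; rewrite !mul1g !mulg1.
Qed.

Variable e : R.
Hypothesis e0 : 0 < e.
Hypothesis conj_le : forall x, p x < e ->
  p (x ^ s)%g <= 2 * p x /\ p (x ^ s^-1)%g <= 2 * p x.
Hypothesis sep : forall x, p x = 0 -> x = 1%g.

Let p_gt0 x : x <> 1%g -> 0 < p x.
Proof.
move=> x1; rewrite lt_neqAle (length_ge0 lp) andbT eq_sym.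
by apply/eqP => /sep.
Qed.

(* Writing [x = a * t * b] with [t = s] or [t = s^-1], one has
   [t^-1 * x = a ^ t * b]. *)
Let shift_le (t a b : G) : t = s \/ t = s^-1%g -> p a < e ->
  p (t^-1 * (a * t * b))%g <= 2 * (p a + p b).
Proof.
move=> ts ae; have -> : (t^-1 * (a * t * b) = a ^ t * b)%g by rewrite conjgE !mulgA.
have : p (a ^ t)%g <= 2 * p a by case: ts => ->; case: (conj_le ae).
by have := lengthM lp (a ^ t)%g b; have := length_ge0 lp b; lra.
Qed.

(** A factorization with [p a >= e] costs at least [e]; in any other, [a] can be carried across [s]
    or [s^-1] by [shift_le], and the cost is at least [u / 2] or [v / 2]. *)
Lemma biinv_dist_gt0 x : x <> s -> x <> s^-1%g -> 0 < D x.
Proof.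
move=> xs xsV; set u := p (s^-1 * x)%g; set v := p (s * x)%g.
have u0 : 0 < u.
  by apply: p_gt0 => /mulg1_eq; rewrite invgK => /esym.
have v0 : 0 < v by apply: p_gt0 => /mulg1_eq /esym.
apply: (@lt_le_trans _ _ (Num.min e (Num.min (u / 2) (v / 2)))).
  by rewrite !lt_min e0 !divr_gt0.
apply: biinv_dist_ge => a b xE; have pb := length_ge0 lp b.
have [ae|] := ltP (p a) e; last first.
  by move=> ea; rewrite !ge_min; apply/orP; left; lra.
rewrite !ge_min; apply/orP; right; case: xE => xE.
  by have := shift_le b (or_introl erefl) ae; rewrite -xE -/u => h; apply/orP; left; lra.
have := shift_le b (or_intror erefl) ae; rewrite -xE invgK -/v => h.
by apply/orP; right; lra.
Qed.

Lemma biinv_dist_lower t : t = s \/ t = s^-1%g ->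
  exists2 r, 0 < r & forall y, p y < r -> p y <= 2 * D (t * y)%g.
Proof.
move=> ts; have tsV : t^-1%g = s \/ t^-1%g = s^-1%g.
  by case: ts => ->; rewrite ?invgK; [right|left].
have rep (x a b : G) : (x = a * s * b \/ x = a * s^-1 * b)%g ->
    (x = a * t * b \/ x = a * t^-1 * b)%g.
  by case: ts => ->; rewrite ?invgK; tauto.
have main y a b : p y < e -> (t * y = a * t * b)%g -> p y <= 2 * (p a + p b).
  move=> ye tyE; have pb := length_ge0 lp b.
  have [ae|ea] := ltP (p a) e; last by have := e0; lra.
  by have := shift_le b ts ae; rewrite -tyE mulKg.
have [t2|t2] := pselect (t * t = 1)%g.
  exists e => // y ye; rewrite -ler_pdivrMl//; apply: biinv_dist_ge => a b.
  move=> /rep; rewrite (invg_sq1 t2) => tyE.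
  by rewrite ler_pdivrMl//; apply: main => //; case: tyE.
(* The second bound handles factorizations through [t^-1]: there [p (t * t * y) <= 2 * (p a + p b)],
   while [p (t * t * y) >= p (t * t) - p y > p y]. *)
exists (Num.min e (p (t * t)%g / 2)).
  by rewrite lt_min e0 divr_gt0// p_gt0.
move=> y; rewrite lt_min => /andP[ye yt]; rewrite -ler_pdivrMl//.
apply: biinv_dist_ge => a b /rep tyE; rewrite ler_pdivrMl//.
case: tyE => tyE; first exact: main.
have pb := length_ge0 lp b; have [ae|ea] := ltP (p a) e; last by have := e0; lra.
have := shift_le b tsV ae; rewrite -tyE invgK mulgA.
have := lengthM lp (t * t * y)%g y^-1%g; rewrite mulgK (lengthV lp).
lra.
Qed.

End SubadditiveLengths.

Section WeightedSum.
Context {R : realType} {G : groupType}.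
Variables (q : G -> R) (b : nat -> G -> R).
Hypotheses (b1 : forall m, b m 1%g = 0) (bV : forall m x, b m x^-1%g = b m x).
Hypothesis bM : forall m x y, `|b m (x * y)%g - b m x| <= q y.

Definition bump_sum (N : nat) (x : G) : R := \sum_(m < N) 8^-1 ^+ m.+1 * b m x.

Lemma bump_sumS N x : bump_sum N.+1 x = bump_sum N x + 8^-1 ^+ N.+1 * b N x.
Proof. exact: big_ord_recr. Qed.

Let pow_ge0 n : 0 <= 8^-1 ^+ n :> R.
Proof. by apply: exprn_ge0; rewrite invr_ge0. Qed.

(** The constant is the sum of the weights [8^-(m+1)] over [N <= m < N + k]. *)
Let increment_le N k x y :
  `|(bump_sum (N + k) (x * y)%g - bump_sum N (x * y)%g)
    - (bump_sum (N + k) x - bump_sum N x)| <=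
  (8^-1 ^+ N - 8^-1 ^+ (N + k)) / 7 * q y.
Proof.
elim: k => [|k IH]; first by rewrite addn0 !subrr normr0 mul0r mul0r.
rewrite addnS !bump_sumS exprS; have := bM (N + k) x y.
set z := 8^-1 ^+ (N + k) in IH *; have z0 : 0 <= z by exact: pow_ge0.
move: IH; rewrite !ler_norml => /andP[h1 h2] /andP[h3 h4].
have := ler_wpM2l z0 h3; have := ler_wpM2l z0 h4.
move=> h5 h6; apply/andP; split; nra.
Qed.

Definition bump_limit (x : G) : R := limn (fun N => bump_sum N x).

Let q_ge0 x : 0 <= q x.
Proof. exact: le_trans (normr_ge0 _) (bM 0 1%g x). Qed.

Lemma bump_sum_cvg x : (bump_sum N x) @[N --> \oo] --> bump_limit x.
Proof.
rewrite /bump_limit.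
have -> : (fun N => bump_sum N x) = series (fun m => 8^-1 ^+ m.+1 * b m x).
  by apply/funext => N; rewrite /series /= big_mkord.
suff h : cvgn (series (fun m => 8^-1 ^+ m.+1 * b m x)) by exact: h.
apply: normed_cvg; apply: (series_le_cvg _ _ _ (@is_cvg_geometric_series _ (q x / 8) 8^-1 _)).
- by move=> n /=.
- by move=> n /=; rewrite mulr_ge0 ?divr_ge0 ?pow_ge0.
- move=> n /=; rewrite normrM ger0_norm ?pow_ge0// exprS.
  have : `|b n x| <= q x by have := bM n 1%g x; rewrite mul1g b1 subr0.
  by move=> /(ler_wpM2l (pow_ge0 n)); lra.
- by rewrite ger0_norm ?invr_ge0//; lra.
Qed.

Lemma bump_limit1 : bump_limit 1%g = 0.
Proof.
rewrite /bump_limit (_ : (fun N => _) = fun=> 0) ?lim_cst//.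
by apply/funext => N; rewrite /bump_sum big1// => i _; rewrite b1 mulr0.
Qed.

Lemma bump_limitV x : bump_limit x^-1%g = bump_limit x.
Proof.
rewrite /bump_limit; congr (limn _); apply/funext => N.
by apply: eq_bigr => i _; rewrite bV.
Qed.

Lemma bump_limit_tail N x y :
  `|(bump_limit (x * y)%g - bump_sum N (x * y)%g) - (bump_limit x - bump_sum N x)|
  <= 8^-1 ^+ N / 7 * q y.
Proof.
apply/ler_addgt0Pr => e e0; have e2 : 0 < e / 2 by rewrite divr_gt0.
have /cvgrPdist_lt/(_ _ e2) h1 := @bump_sum_cvg (x * y)%g.
have /cvgrPdist_lt/(_ _ e2) h2 := @bump_sum_cvg x.
have [M [[/= hxy hx] NM]] := filter_ex (filterI (filterI h1 h2) (nbhs_infty_ge N)).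
have := increment_le N (M - N) x y; rewrite subnKC//.
have : 0 <= 8^-1 ^+ M / 7 * q y by rewrite mulr_ge0 ?divr_ge0 ?pow_ge0.
move: hxy hx; rewrite !ltr_norml !ler_norml => /andP[? ?] /andP[? ?] ? /andP[? ?].
by apply/andP; split; lra.
Qed.

End WeightedSum.

Section BumpLength.
Context {R : realType} {G : topologicalGroupType}.
Variables (p : G -> R) (xs : nat -> G).
Hypotheses (pp : proper_length p) (sep : forall x, p x = 0 -> x = 1%g).
Hypothesis conj_le : forall i, exists2 e, 0 < e & forall x, p x < e ->
  p (x ^ xs i)%g <= 2 * p x /\ p (x ^ (xs i)^-1)%g <= 2 * p x.
Hypothesis nondisc : ~ nbhs (1%g : G) [set 1%g].

Let lp : length_fun p. Proof. by case: pp. Qed.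

Definition sqrt_length (x : G) : R := Num.sqrt (p x).

Local Notation q := sqrt_length.

Let q_ge0 x : 0 <= q x. Proof. exact: sqrtr_ge0. Qed.

Let qK x : q x ^+ 2 = p x. Proof. by rewrite sqr_sqrtr// (length_ge0 lp). Qed.

Let qV x : q x^-1%g = q x. Proof. by rewrite /q (lengthV lp). Qed.

Let q1 : q 1%g = 0. Proof. by rewrite /q (length1 lp) sqrtr0. Qed.

(** The square of the right side contains the cross term [q x * q y >= p y]. *)
Lemma sqrt_lengthM_half x y : q y <= q x -> q (x * y)%g <= q x + q y / 2.
Proof.
move=> yx; have h : 0 <= q x + q y / 2 by rewrite addr_ge0 ?divr_ge0.
rewrite -[leRHS]ger0_norm// -sqrtr_sqr; apply: ler_wsqrtr.
apply: le_trans (lengthM lp x y) _; rewrite -!qK.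
have := ler_wpM2r (q_ge0 y) yx; have := q_ge0 y; nra.
Qed.

(** The square root produces a cusp, on the scale of [q], at [xs m] and its inverse and nowhere
    else. Subtracting the value at [1] makes the function vanish there, as a length must. *)
Definition bump (m : nat) (x : G) : R :=
  Num.sqrt (biinv_dist p (xs m) x) - Num.sqrt (biinv_dist p (xs m) 1%g).

Let bump1 m : bump m 1%g = 0. Proof. exact: subrr. Qed.

Let bumpV m x : bump m x^-1%g = bump m x.
Proof. by rewrite /bump biinv_distV. Qed.

Let bumpM m x y : `|bump m (x * y)%g - bump m x| <= q y.
Proof.
rewrite /bump opprB addrA subrK; apply: sqrt_dist_le; try exact: biinv_dist_ge0.
exact: biinv_distM.
Qed.

Local Notation h := (bump_limit bump).
Local Notation hs := (bump_sum bump).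

Let tail := bump_limit_tail bump1 bumpM.

Let hM x y : `|h (x * y)%g - h x| <= q y / 7.
Proof.
have := tail 0 x y; rewrite /bump_sum !big_ord0 !subr0 expr0.
by rewrite mul1r mulrC.
Qed.

Let h_le x : `|h x| <= q x / 7.
Proof. by have := hM 1%g x; rewrite mul1g (bump_limit1 bump1) subr0. Qed.

Definition bump_length (x : G) : R := q x + h x.

Local Notation l := bump_length.

Let lE x : l x = q x + h x. Proof. by []. Qed.

Let l_ge x : 6 / 7 * q x <= l x.
Proof. by have := h_le x; rewrite ler_norml /l => /andP[? ?]; lra. Qed.

Let l_le x : l x <= 8 / 7 * q x.
Proof. by have := h_le x; rewrite ler_norml /l => /andP[? ?]; lra. Qed.

Lemma bump_length_fun : length_fun l.
Proof.
have lV x : l x^-1%g = l x by rewrite /l qV (bump_limitV bumpV).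
split=> //.
- by rewrite /l q1 (bump_limit1 bump1) addr0.
- by move=> x; apply: le_trans (l_ge x); rewrite mulr_ge0 ?divr_ge0.
(* The increment of [l] is at most [(1/2 + 1/7) * q y], while [l y >= 6/7 * q y]. The opposite case
   follows by passing to inverses. *)
have le x y : q y <= q x -> l (x * y)%g <= l x + l y.
  move=> /sqrt_lengthM_half; have := hM x y; have := l_ge y; have := q_ge0 y.
  by rewrite ler_norml {2 3}/l => ? ? /andP[? ?] ?; lra.
move=> x y; have [/le//|/ltW xy] := leP (q y) (q x).
by rewrite -lV invgM -(lV x) -(lV y) addrC; apply: le; rewrite !qV.
Qed.

Let q_lt x r : 0 < r -> (q x < r) = (p x < r ^+ 2).
Proof.
by move=> r0; rewrite -qK ltr_pXn2r ?nnegrE ?q_ge0 ?(ltW r0).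
Qed.

Lemma bump_length_proper : proper_length l.
Proof.
have [_ nb pr] := pp; split; first exact: bump_length_fun.
- move=> U; split=> [/nb[r r0 rU]|[r r0 rU]].
    exists (6 / 7 * Num.sqrt r); first by rewrite mulr_gt0 ?divr_gt0 ?sqrtr_gt0.
    move=> x /= lx; apply: rU => /=; rewrite -(sqr_sqrtr (ltW r0)).
    by rewrite -q_lt ?sqrtr_gt0//; have := l_ge x; lra.
  have r7 : 0 < 7 / 8 * r by move: r0 => /= r0; lra.
  apply/nb; exists ((7 / 8 * r) ^+ 2); first exact: exprn_gt0.
  move=> x /=; rewrite -q_lt// => qx.
  by apply: rU => /=; have := l_le x; lra.
- move=> r; have [C cC pC] := pr ((7 / 6 * r) ^+ 2); exists C => // x /= lx.
  apply: pC => /=; rewrite -qK; have := l_ge x; have := q_ge0 x => ? ?.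
  by rewrite ler_pXn2r// ?nnegrE; lra.
Qed.

(** As [p = q ^ 2], the increment is quadratic in [q y]: [u] has slope zero at [x] with respect to
    [q]. *)
Definition flat (u : G -> R) (x : G) :=
  exists2 K, 0 <= K & forall y, `|u (x * y)%g - u x| <= K * p y.

Let flat_sqrt_length x : x <> 1%g -> flat q x.
Proof.
move=> x1; have px : 0 < p x.
  by rewrite lt_neqAle (length_ge0 lp) andbT eq_sym; apply/eqP => /sep.
exists (Num.sqrt (p x))^-1; first by rewrite invr_ge0 sqrtr_ge0.
move=> y; apply: sqrt_dist_flat => //; first exact: (length_ge0 lp).
exact: lengthM_sub.
Qed.

Let flat_bump m x : x <> xs m -> x <> (xs m)^-1%g -> flat (bump m) x.
Proof.
move=> xm xmV; have [e e0 ce] := conj_le m.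
have Dx := biinv_dist_gt0 lp e0 ce sep xm xmV.
exists (Num.sqrt (biinv_dist p (xs m) x))^-1; first by rewrite invr_ge0 sqrtr_ge0.
move=> y; rewrite /bump opprB addrA subrK.
by apply: sqrt_dist_flat => //; [exact: biinv_dist_ge0|exact: biinv_distM].
Qed.

Let flatD u v x : flat u x -> flat v x -> flat (fun z => u z + v z) x.
Proof.
move=> [K K0 uK] [L L0 vL]; exists (K + L); first exact: addr_ge0.
move=> y; rewrite opprD addrACA mulrDl; apply: le_trans (ler_normD _ _) _.
exact: lerD.
Qed.

Let flatZ c u x : 0 <= c -> flat u x -> flat (fun z => c * u z) x.
Proof.
move=> c0 [K K0 uK]; exists (c * K); first exact: mulr_ge0.
by move=> y; rewrite -mulrBr normrM (ger0_norm c0) -mulrA ler_wpM2l.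
Qed.

Let pow_gt0 n : 0 < 8^-1 ^+ n :> R.
Proof. by apply: exprn_gt0; rewrite invr_gt0. Qed.

Definition sym_at n x := x = xs n \/ x = (xs n)^-1%g.

Let flat_part N x : x <> 1%g -> (forall i, (i < N)%N -> ~ sym_at i x) ->
  flat (fun z => q z + hs N z) x.
Proof.
move=> x1; elim: N => [_|N IH hN].
  have -> : (fun z => q z + hs 0 z) = q; last exact: flat_sqrt_length.
  by apply/funext => z; rewrite /bump_sum big_ord0 addr0.
have -> : (fun z => q z + hs N.+1 z) =
    (fun z => (q z + hs N z) + 8^-1 ^+ N.+1 * bump N z).
  by apply/funext => z; rewrite bump_sumS addrA.
apply: flatD; first by apply: IH => i iN; apply: hN; rewrite ltnS ltnW.
apply: flatZ; first exact: ltW.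
by apply: flat_bump => e; apply: (hN N (ltnSn N)); [left|right].
Qed.

(** Stated through [l] alone, hence invariant under isometries fixing [1]. In units of [8^-(n+1)],
    the threshold [1/4] equals the upper bound [(1/14 + 1/7) / (6/7)] of [not_steep] and lies below
    the lower bound [(1/2 - 1/28 - 1/7) / (8/7) = 9/32] of [steep_at]. *)
Definition steep n x := forall e, 0 < e -> exists y,
  [/\ 0 < l y, l y < e & 8^-1 ^+ n.+1 / 4 * l y < `|l (x * y)%g - l x|].

(* The [n+1]-st tail of the series has Lipschitz constant [8^-(n+1) / 7]. *)
Lemma not_steep n x : x <> 1%g -> (forall i, (i <= n)%N -> ~ sym_at i x) ->
  ~ steep n x.
Proof.
move=> x1 hx; have [K K0 hK] := @flat_part n.+1 x x1 hx.
have := pow_gt0 n.+1; set c := 8^-1 ^+ n.+1 => c0.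
move=> /(_ (c / (28 * (K + 1)))) [|y [ly lye]].
  by rewrite divr_gt0// mulr_gt0// ltr_wpDl.
apply/negP; rewrite -leNgt.
have qy := q_ge0 y; have := l_ge y => lq.
have Kq : K * q y <= c / 14.
  move: lye; rewrite ltr_pdivlMr; last by rewrite mulr_gt0// ltr_wpDl.
  have := ler_wpM2l K0 lq; lra.
have /andP[h1 h2] : (- (K * p y) <= (q (x * y)%g + hs n.+1 (x * y)%g) - (q x + hs n.+1 x)
   <= K * p y) by rewrite -ler_norml; exact: hK.
have := tail n.+1 x y; rewrite -/c !ler_norml => /andP[h3 h4].
have h5 : K * p y <= c / 14 * q y by rewrite -qK expr2 mulrA ler_wpM2r.
have := ler_wpM2l (ltW c0) lq => h6.
by rewrite (lE (x * y)%g) (lE x); apply/andP; split; lra.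
Qed.

Lemma steep_at n x : x <> 1%g -> sym_at n x -> (forall i, (i < n)%N -> ~ sym_at i x) ->
  steep n x.
Proof.
move=> x1 xn hx e e0; have [K K0 hK] := @flat_part n x x1 hx.
have := pow_gt0 n.+1; set c := 8^-1 ^+ n.+1 => c0.
have [d d0 cd] := conj_le n.
have [r r0 hr] := biinv_dist_lower lp d0 cd sep xn.
pose t := Num.min (e / 2) (Num.min (c / (28 * (K + 1))) (Num.sqrt r)).
have t0 : 0 < t.
  by rewrite !lt_min !divr_gt0 ?sqrtr_gt0// mulr_gt0// ltr_wpDl.
(* Nondiscreteness provides arbitrarily short nontrivial elements. *)
have [y y1 qyt] : exists2 y, y <> 1%g & q y < t.
  apply: contrapT => /forall2NP hy; apply: nondisc; case: pp => _ nb _.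
  apply/nb; exists (t ^+ 2); first exact: exprn_gt0.
  move=> y /=; rewrite -q_lt// => qyt.
  by case: (hy y) => // /contrapT.
have qy0 : 0 < q y.
  rewrite /q sqrtr_gt0 lt_neqAle (length_ge0 lp) andbT eq_sym.
  by apply/eqP => /sep.
move: qyt; rewrite !lt_min => /and3P[qye qyc qyr].
have lq := l_ge y; have lq' := l_le y.
exists y; split; [lra|lra|].
have Kq : K * q y <= c / 28.
  move: qyc; rewrite ltr_pdivlMr; last by rewrite mulr_gt0// ltr_wpDl.
  lra.
have /andP[h1 h2] : (- (K * p y) <= (q (x * y)%g + hs n (x * y)%g) - (q x + hs n x)
   <= K * p y) by rewrite -ler_norml; exact: hK.
have := tail n.+1 x y; rewrite -/c !bump_sumS -/c ler_norml => /andP[h3 h4].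
have h5 : K * p y <= c / 28 * q y by rewrite -qK expr2 mulrA ler_wpM2r.
(* The distance to [{xs n, (xs n)^-1}] vanishes at [x] and is at least [p y / 2], hence at least
   [(q y / 2) ^ 2], at [x * y]. *)
have bxy : q y / 2 <= bump n (x * y)%g - bump n x.
  rewrite /bump opprB addrA subrK (biinv_dist_self lp xn) sqrtr0 subr0.
  rewrite -[leLHS]ger0_norm ?divr_ge0// -sqrtr_sqr ler_wsqrtr// expr_div_n qK.
  have py : p y < r by rewrite -(sqr_sqrtr (ltW r0)) -q_lt// sqrtr_gt0.
  by have := hr y py; have := biinv_dist_ge0 lp (xs n) (x * y)%g; lra.
have h6 := ler_wpM2l (ltW c0) bxy.
have h7 := ler_wpM2l (ltW c0) lq'.
have h8 := mulr_gt0 c0 qy0.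
by rewrite (lE (x * y)%g) (lE x) ltr_normr; apply/orP; left; lra.
Qed.

Let steep_isometry (f : G -> G) n x :
  (forall y z, length_dist l (f y) (f z) = length_dist l y z) -> f 1%g = 1%g ->
  (forall y, exists z, f z = y) -> steep n x -> steep n (f x).
Proof.
move=> fl f1 fsurj sx e e0; have [y [ly ye sy]] := sx e e0.
have lf := length_dist_fix1 fl f1.
have ly' : l ((f x)^-1 * f (x * y))%g = l y.
  by have := fl x (x * y)%g; rewrite /length_dist mulKg.
by exists ((f x)^-1 * f (x * y))%g; rewrite mulVKg !lf ly'.
Qed.

Let sym_at_eq n x y : sym_at n x -> sym_at n y -> y = x \/ y = x^-1%g.
Proof. by move=> [] -> [] ->; rewrite ?invgK; tauto. Qed.

Let sym_least x : (exists n, sym_at n x) ->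
  exists2 n, sym_at n x & forall i, (i < n)%N -> ~ sym_at i x.
Proof.
move=> ex; have ex' : exists n, `[< sym_at n x >] by case: ex => n /asboolP; exists n.
case: (ex_minnP ex') => n /asboolP xn nmin; exists n => // i i_n /asboolP/nmin.
by rewrite leqNgt i_n.
Qed.

(** By [steep_at] and [not_steep], the least index at which [x <> 1] occurs up to inversion is the
    least [n] with [steep n x]. So [x] and [f x] have the same least index. *)
Lemma bump_length_isometry (f g : G -> G) : cancel f g -> cancel g f ->
  (forall x y, length_dist l (f x) (f y) = length_dist l x y) -> f 1%g = 1%g ->
  forall i, f (xs i) = xs i \/ f (xs i) = (xs i)^-1%g.
Proof.
move=> fK gK fl f1 i; set x := xs i.
have [x1|/eqP x1] := eqVneq x 1%g; first by rewrite x1 f1; left.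
have gl y z : length_dist l (g y) (g z) = length_dist l y z by rewrite -fl !gK.
have g1 : g 1%g = 1%g by rewrite -f1 fK.
have fx1 : f x <> 1%g by move=> fx1; apply: x1; rewrite -(fK x) fx1.
have steep_f n : steep n x -> steep n (f x).
  by apply: steep_isometry => // y; exists (g y).
have steep_g n : steep n (f x) -> steep n x.
  by rewrite -{2}(fK x); apply: steep_isometry => // y; exists (f y).
have [|n xn nmin] := @sym_least x; first by exists i; left.
have steep_le m z : z <> 1%g -> steep m z -> exists2 j, (j <= m)%N & sym_at j z.
  move=> z1 mz; apply: contrapT => /forall2NP h; apply: not_steep mz => // j jm zj.
  by case: (h j).
have [j jn fxj] := steep_le n (f x) fx1 (steep_f n (steep_at x1 xn nmin)).
have [|m fxm mmin] := @sym_least (f x); first by exists j.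
have mn : (m <= n)%N.
  by rewrite leqNgt; apply/negP => nm; apply: (mmin j) fxj; exact: leq_ltn_trans nm.
have [k km xk] := steep_le m x x1 (steep_g m (steep_at fx1 fxm mmin)).
have nm : (n <= m)%N.
  by rewrite leqNgt; apply/negP => mn'; apply: (nmin k) xk; exact: leq_ltn_trans mn'.
have mE : m = n by apply/eqP; rewrite eqn_leq mn.
by apply: sym_at_eq xn _; rewrite -mE.
Qed.

End BumpLength.

(** * The translation metric and its isometry group *)

Lemma isometry_continuous (R : realType) (S T : topologicalType) (dS : S -> S -> R)
    (dT : T -> T -> R) (f : S -> T) :
  induces_topology dS -> induces_topology dT ->
  (forall x y, dT (f x) (f y) = dS x y) -> continuous f.
Proof.
move=> tS tT fd x U; rewrite tT => -[r r0 rU].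
change (nbhs x (f @^-1` U)); rewrite tS; exists r => // y /= xy.
by apply: rU; rewrite /= fd.
Qed.

Definition fixing_isometry {R : realType} {G : groupType} (l : G -> R) (f : G -> G) :=
  [/\ bijective f, forall x y, length_dist l (f x) (f y) = length_dist l x y
    & f 1%g = 1%g].

Lemma rigid_length_ex (R : realType) (G : topologicalGroupType) :
  polish_space R G -> locally_compact [set: G] ->
  exists l : G -> R, [/\ proper_length l, Metr_c R G (length_dist l) &
    exists2 D : set G, dense D & forall f, fixing_isometry l f ->
      forall x, D x -> f x = x \/ f x = x^-1%g].
Proof.
move=> [sepG [d [dm dG _]]] lcG.
have hG := metric_hausdorff_space dm dG.
have [xs dxs] := separable_range 1%g sepG.
have [p pp conj_le] := proper_length_ex dG lcG dxs.
have sep x : p x = 0 -> x = 1%g.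
  have [[_ h _ _] _ _] := proper_length_Metr_c hG pp.
  move=> px; apply/esym; apply/(h 1%g x).
  by rewrite /length_dist invg1 mul1g.
have [disc|nondisc] := pselect (nbhs (1%g : G) [set 1%g]).
  exists (discrete_length p dxs disc).
  have dp := discrete_length_proper pp dxs disc.
  split=> //; first exact: proper_length_Metr_c.
  exists (range xs) => // f [_ fl f1] _ [i _ <-].
  apply: (@discrete_length_inj _ _ _ _ pp dxs disc).
  by rewrite (length_dist_fix1 fl f1).
exists (bump_length p xs).
have bp : proper_length (bump_length p xs) by exact: bump_length_proper.
split=> //; first exact: proper_length_Metr_c.
exists (range xs) => // f [[g fK gK] fl f1] _ [i _ <-].
exact: (bump_length_isometry pp sep conj_le nondisc fK gK).
Qed.

(** The set of [x] with [f x = x] or [f x = x^-1] is closed, since [f] is continuous, and it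
    contains a dense set. *)
Lemma fixing_isometry_inv (R : realType) (G : topologicalGroupType) (l : G -> R)
    (D : set G) :
  hausdorff_space G -> induces_topology (length_dist l) -> dense D ->
  (forall f, fixing_isometry l f -> forall x, D x -> f x = x \/ f x = x^-1%g) ->
  forall f, fixing_isometry l f -> forall x, f x = x \/ f x = x^-1%g.
Proof.
move=> hG lG dD hD f iso_f x.
have fc : continuous f by case: iso_f => _ fl _; exact: (isometry_continuous lG lG fl).
pose E := [set x | (f x * x^-1)%g = 1%g] `|` [set x | (f x * x)%g = 1%g].
have cE : closed E.
  apply: closedU.
    apply: (@preimage_closed _ _ (fun x => f x * x^-1)%g [set 1%g]) => [y _|].
      by apply: cvg_mulg; [exact: fc|exact: invg_continuous].
    by apply: accessible_closed_set1; exact: hausdorff_accessible.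
  apply: (@preimage_closed _ _ (fun x => f x * x)%g [set 1%g]) => [y _|].
    by apply: cvg_mulg; [exact: fc|exact: cvg_id].
  by apply: accessible_closed_set1; exact: hausdorff_accessible.
have EE y : E y <-> f y = y \/ f y = y^-1%g.
  split=> [[/= /divg1_eq|/= h]|[fy|fy]]; [by left| |left|right]; rewrite /= ?fy ?mulgV ?mulVg//.
  by right; rewrite -(mulgK y (f y)) h mul1g.
apply/EE; apply: contrapT => nEx.
have [y [nEy Dy]] := dD (~` E) (ex_intro _ x nEx) (closed_openC cE).
by apply: nEy; apply/EE; exact: hD.
Qed.

(** The hypothesis is applied to the isometry [z |-> (f x)^-1 * f (x * z)], which also fixes [1], at
    [z = x^-1 * y]. *)
Lemma fixing_isometry_sign (R : realType) (G : groupType) (l : G -> R) (f : G -> G) :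
  (forall f, fixing_isometry l f -> forall x, f x = x \/ f x = x^-1%g) ->
  fixing_isometry l f -> sign_map f.
Proof.
move=> h iso_f; have [[g fK gK] fl f1] := iso_f.
split=> // x y; have iso_fx : fixing_isometry l (fun z => (f x)^-1 * f (x * z))%g.
  split.
  - exists (fun z => x^-1 * g (f x * z))%g => z; first by rewrite mulVKg fK mulKg.
    by rewrite mulVKg gK mulKg.
  - by move=> y1 y2; rewrite length_dist_left_invariant fl length_dist_left_invariant.
  - by rewrite mulg1 mulVg.
by have := h _ iso_fx (x^-1 * y)%g; rewrite mulVKg invgM invgK.
Qed.

Lemma cond_iii_cond_ii (R : realType) (G : topologicalGroupType) :
  polish_space R G -> locally_compact [set: G] -> cond_iii G -> cond_ii R G.
Proof.
move=> polG lcG ciii.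
have [l [pl Ml [D dD hD]]] := rigid_length_ex polG lcG.
have [dm dG pr] := Ml; have hG := metric_hausdorff_space dm dG.
have sgn f : fixing_isometry l f -> sign_map f.
  by apply: fixing_isometry_sign; exact: fixing_isometry_inv hG dG dD hD.
have fix_id f : fixing_isometry l f -> forall x, f x = x.
  move=> /sgn sf x; have [B|[nab nexc]] := ciii.
    by case: (sign_map_val sf x) => ->//; apply: invg_sq1; exact: B.
  apply: contrapT => fx; apply: nexc; apply: sign_map_exceptional sf _ => //.
  by exists x.
exists (length_dist l); split=> //; first exact: length_dist_left_invariant.
apply/seteqP; split=> f.
  (* Followed by translation by [(f 1)^-1], an isometry fixes [1] and so becomes the identity. *)
  move=> [[g fK gK] fl]; exists (f 1%g) => //; apply/funext => x.
  have iso_f : fixing_isometry l (fun z => (f 1%g)^-1 * f z)%g.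
    split.
    - exists (fun z => g (f 1%g * z))%g => z; first by rewrite mulVKg fK.
      by rewrite gK mulKg.
    - by move=> y1 y2; rewrite length_dist_left_invariant fl.
    - by rewrite mulVg.
  by rewrite -{1}(fix_id _ iso_f x) mulVKg.
move=> [a _ <-]; split; last by move=> x y; exact: length_dist_left_invariant.
by exists (fun x => a^-1 * x)%g => x; [exact: mulKg|exact: mulVKg].
Qed.

Lemma ptws_continuous (S V : topologicalType) (U : Type) (F : S -> {ptws U -> V}) :
  (forall u, continuous (fun s => F s u)) -> continuous F.
Proof.
move=> h s; apply/cvg_sup => u.
exact: (@continuous_comp_initial _ S V (fun f : U -> V => f u) F (h u) s).
Qed.

(** * The isometry group as a copy of the group *)

Section TranslationMetric.
Context {R : realType} {G : topologicalGroupType} (rho : G -> G -> R).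
Hypothesis lt : left_translation_metric rho.

Let isoE : Iso rho = range (fun a x : G => (a * x)%g). Proof. by case: lt. Qed.

Let translation_iso a : Iso rho (fun x => a * x)%g.
Proof. by rewrite isoE; exists a. Qed.

Let translation (a : G) : isom rho := SigSub (mem_set (translation_iso a)).

Let isomE (u : isom rho) x : isom_fun u x = (isom_fun u 1 * x)%g.
Proof.
have : Iso rho (isom_fun u) by exact: isom_funP.
by rewrite isoE => -[a _ <-]; rewrite mulg1.
Qed.

Let eval1_continuous : continuous (fun u : isom rho => isom_fun u 1%g).
Proof.
move=> u; apply: (@continuous_comp _ _ _ (fun u : isom rho => isom_fun u : {ptws G -> G})
  (fun f : {ptws G -> G} => f 1%g)); first exact: initial_continuous.
exact: (@proj_continuous G (fun=> G) 1%g).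
Qed.

Let translation_continuous : continuous translation.
Proof.
apply: continuous_comp_initial; apply: ptws_continuous => x a.
by apply: cvg_mulg; [exact: cvg_id|exact: cvg_cst].
Qed.

Let translationK (u : isom rho) : translation (isom_fun u 1%g) = u.
Proof. by apply: isom_ext => x; rewrite [RHS]isomE. Qed.

Lemma translation_metric_isomorphic : topgroup_isomorphic (isom rho) G.
Proof.
exists (fun u => isom_fun u 1%g), translation; split.
- by move=> u v; rewrite -(isomE u).
- exact: translationK.
- by move=> a; exact: mulg1.
- exact: eval1_continuous.
- exact: translation_continuous.
Qed.

Lemma translation_metric_continuous_action : continuous_action (@isom_fun R G rho).
Proof.
split=> //; have -> : (fun p => isom_fun p.1 p.2) =
    (fun p : isom rho * G => isom_fun p.1 1 * p.2)%g.
  by apply/funext => p; exact: isomE.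
move=> p; apply: cvg_mulg; last exact: cvg_snd.
apply: (@continuous_comp _ _ _ (@fst (isom rho) G) (fun u => isom_fun u 1%g)).
  exact: cvg_fst.
exact: eval1_continuous.
Qed.

Lemma translation_metric_free : free_action (@isom_fun R G rho).
Proof.
move=> u [x]; rewrite isomE => ux; apply: isom_ext => y.
by rewrite isomE; have -> : isom_fun u 1%g = 1%g by apply: (mulIg x); rewrite ux mul1g.
Qed.

Lemma translation_metric_transitive : transitive_action (@isom_fun R G rho).
Proof.
exists 1%g; apply/seteqP; split=> // x _; exists (translation x) => //.
exact: mulg1.
Qed.

(** The only translation taking [x] to [y] is the one by [y * x^-1], so the preimage of [K] is a
    continuous image of [K]. *)
Lemma translation_metric_proper_action : proper_action (@isom_fun R G rho).
Proof.
move=> K cK; pose j (p : G * G) := (translation (p.2 * p.1^-1)%g, p.1).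
have -> : [set p : isom rho * G | K (p.2, isom_fun p.1 p.2)] = j @` K.
  apply/seteqP; split=> [[u x] /= Kux|_ [[x y] Kxy <-]].
    by exists (x, isom_fun u x) => //; rewrite /j /= isomE mulgK translationK.
  have e : isom_fun (j (x, y)).1 x = y by exact: mulgVK.
  by rewrite -{1}e in Kxy.
apply: continuous_compact => //; apply: continuous_subspaceT => p.
have c : (fun p : G * G => translation (p.2 * p.1^-1)%g) p @[p --> p] -->
    translation (p.2 * p.1^-1)%g.
  apply: (@continuous_comp _ _ _ (fun p : G * G => p.2 * p.1^-1)%g translation).
    apply: cvg_mulg; first exact: cvg_snd.
    by apply: cvg_invg; exact: cvg_fst.
  exact: translation_continuous.
exact: (cvg_pair c cvg_fst).
Qed.

End TranslationMetric.

(** * Dense orbits *)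

Section Metrized.
Context {R : realType} {T : topologicalType} (d : T -> T -> R).

(* [T] with the topology of [d] as a [metricType]; the proof argument makes the
   instances below canonical for this alias only. *)
Definition metrized (dm : is_metric d) : Type := T.

Variable dm : is_metric d.

HB.instance Definition _ := Choice.copy (metrized dm) T.

Let dxx (x : metrized dm) : d x x = 0. Proof. exact: metric_distxx. Qed.

Let d_eq (x y : metrized dm) : d x y = 0 -> x = y.
Proof. by have [_ h _ _] := dm; move/h. Qed.

Let d_sym (x y : metrized dm) : d x y = d y x.
Proof. by have [_ _ h _] := dm; exact: h. Qed.

Let d_tri (y x z : metrized dm) : d x z <= d x y + d y z.
Proof. by have [_ _ _ h] := dm; exact: h. Qed.

HB.instance Definition _ := isMetric.Build R (metrized dm) dxx d_eq d_sym d_tri.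

Lemma metrized_nbhs (dT : induces_topology d) (x : T) :
  nbhs (x : metrized dm) = nbhs x.
Proof.
rewrite dT; apply/seteqP; split=> U.
  by move=> /nbhs_ballP[r r0 rU]; exists r.
by move=> [r r0 rU]; apply/nbhs_ballP; exists r.
Qed.

End Metrized.

(** A tail of a Cauchy sequence lies in a compact ball, and a cluster point is its limit. *)
Lemma proper_metric_complete (R : realType) (T : topologicalType) (d : T -> T -> R) :
  Metr_c R T d -> complete_metric d.
Proof.
move=> [[ge0 eq0 sym tri] dT pr] u cu.
have cauchy e : 0 < e -> exists N, forall m n, (N <= m)%N -> (N <= n)%N -> d (u m) (u n) < e.
  move=> /cu[[A B] /= [[N1 _ h1] [N2 _ h2]] AB]; exists (maxn N1 N2) => m n.
  rewrite !geq_max => /andP[m1 _] /andP[_ n2].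
  by apply: (AB (m, n)); split=> /=; [exact: h1|exact: h2].
have [N hN] := cauchy 1 ltr01.
have [l [_ cl]] : [set y | d (u N) y <= 1] `&` cluster (u @ \oo) !=set0.
  apply: pr; exists N => // n Nn /=; apply: ltW; exact: hN.
exists l; apply/cvgrPdist_lt => e e0; have e2 : 0 < e / 2 by rewrite divr_gt0.
have [M hM] := cauchy _ e2; exists M => // n /= Mn.
have b1 : (u @ \oo) [set u k | k in [set k | (M <= k)%N]].
  by exists M => // k /= Mk; exists k.
have b2 : nbhs l [set y | d l y < e / 2] by rewrite dT; exists (e / 2).
have [_ [[k /= Mk <-] lk]] := cl _ _ b1 b2.
rewrite sub0r normrN ger0_norm//; have := tri (u n) (u k) l.
by rewrite (sym (u k) l); have := hM n k Mn Mk; move: lk => /=; lra.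
Qed.

Lemma cond_ii_cond_i (R : realType) (G : topologicalGroupType) :
  cond_ii R G -> cond_i R G.
Proof.
move=> [rho [Mrho linv isoE]]; have [dm dT _] := Mrho.
(* [G] acts on itself; [toX] and [ofX] below carry continuity between its topology and that of
   [rho]. *)
pose X := metrized dm; pose act (a : G) (x : X) : X := (a * x)%g.
have nX x : nbhs (x : X) = nbhs (x : G) := metrized_nbhs dm dT x.
have toX : continuous (fun x : G => x : X) by move=> x U; rewrite nX.
have ofX : continuous (fun x : X => x : G) by move=> x U; rewrite -nX.
exists X, act; split.
- exact: proper_metric_complete Mrho.
- split=> [x|g h x|]; [exact: mul1g|by rewrite /act mulgA|].
  move=> p; apply: (@continuous_comp _ _ _ (fun p : G * X => (p.1 * (p.2 : G))%g)
    (fun x : G => x : X)); last exact: toX.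
  apply: cvg_mulg; first exact: cvg_fst.
  by apply: (@continuous_comp _ _ _ snd (fun x : X => x : G)); [exact: cvg_snd|exact: ofX].
- by move=> g h; have := h 1%g; rewrite /act mulg1.
- exact: isoE.
- exists 1%g => O [x Ox] oO; exists x; split=> //; exists x => //.
  exact: mulg1.
Qed.

Section DenseOrbit.
Context {R : realType} {G : topologicalGroupType} {X : metricType R}.
Variables (act : G -> X -> X) (b : X).
Hypotheses (cX : complete_metric (@mdist R X)) (cact : continuous_action act).
Hypotheses (eff : effective_action act) (isoE : Iso (@mdist R X) = range act).
Hypothesis bd : dense (action_orbit act b).

Local Notation d := (@mdist R X).

Let actM g h x : act (g * h)%g x = act g (act h x). Proof. by case: cact. Qed.

Let act1 x : act 1%g x = x. Proof. by case: cact. Qed.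

Let act_iso g x y : d (act g x) (act g y) = d x y.
Proof.
have : Iso (@mdist R X) (act g) by rewrite isoE; exists g.
by case.
Qed.

Let orbit_near x e : 0 < e -> exists g, d x (act g b) < e.
Proof.
move=> e0; have bx : nbhs x (ball x e) by exact: nbhsx_ballx.
move: bx; rewrite nbhsE => -[O [oO Ox] Oe].
have [y [/Oe + [g _ gy]]] := bd (ex_intro _ x Ox) oO.
by rewrite -gy ballEmdist => h; exists g.
Qed.

Let dist_approx x y z : `|d x z - d y z| <= d x y.
Proof.
have := metric_triangle x y z; have := metric_triangle y x z.
by rewrite (metric_sym y x) ler_norml; lra.
Qed.

Let orbit_ext x y : (forall g, d x (act g b) = d y (act g b)) -> x = y.
Proof.
move=> h; apply: mdist_positivity; apply/eqP; rewrite eq_le mdist_ge0 andbT.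
apply/ler_addgt0Pr => e e0; rewrite add0r; have e2 : 0 < e / 2 by rewrite divr_gt0.
have [g hg] := @orbit_near x _ e2; have := metric_triangle x (act g b) y.
by rewrite (metric_sym (act g b)) -h; lra.
Qed.

Let fixes_orbit z : (forall g, act z (act g b) = act g b) -> z = 1%g.
Proof.
move=> h; apply: eff => x; apply: orbit_ext => g.
by rewrite -{1}(h g) act_iso.
Qed.

Variable f : G -> G.
Hypotheses (sf : sign_map f) (fK : involutive f).

Let orbit_dist g h : d (act g b) (act h b) = d b (act (g^-1 * h)%g b).
Proof. by rewrite -(act_iso g^-1%g) -!actM mulVg act1. Qed.

(** Orbit distances depend only on [g^-1 * h], and symmetry of [d] makes them invariant under
    inverting it. *)
Let sign_orbit_dist g h : d (act (f g) b) (act (f h) b) = d (act g b) (act h b).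
Proof.
rewrite !orbit_dist; case: (sf.2 g h) => -> //.
by rewrite -!orbit_dist metric_sym.
Qed.

(** The images of orbit points converging to [x] form a Cauchy sequence by [sign_orbit_dist]; [y] is
    its limit. *)
Let extend_at x : exists y, forall g, d y (act (f g) b) = d x (act g b).
Proof.
have pos n : 0 < n.+1%:R^-1 :> R by rewrite invr_gt0.
have /choice[u hu] : forall n, exists g, d x (act g b) < n.+1%:R^-1.
  by move=> n; exact: orbit_near.
have small e : 0 < e -> \forall n \near \oo, d x (act (u n) b) < e.
  move=> e0; exists (Num.truncn e^-1) => // n /= en.
  apply: lt_le_trans (hu n) _; rewrite invf_ple ?posrE//.
  by apply: le_trans (ltW (truncnS_gt _)) _; rewrite ler_nat ltnS.
have [|y hy] := cX (u := fun n => act (f (u n)) b).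
  move=> e e0; have e2 : 0 < e / 2 by rewrite divr_gt0.
  exists ([set n | d x (act (u n) b) < e / 2], [set n | d x (act (u n) b) < e / 2]).
    by split; exact: small.
  move=> [m n] /= [hm hn]; rewrite sign_orbit_dist.
  have := metric_triangle (act (u m) b) x (act (u n) b).
  by rewrite (metric_sym (act (u m) b) x); lra.
exists y => g; apply/eqP; rewrite -subr_eq0 -normr_eq0 eq_le normr_ge0 andbT.
apply/ler_addgt0Pr => e e0; rewrite add0r; have e2 : 0 < e / 2 by rewrite divr_gt0.
have hy' : \forall n \near \oo, d (act (f (u n)) b) y < e / 2.
  move/cvgrPdist_lt: hy => /(_ _ e2); apply: filterS => n.
  by rewrite sub0r normrN ger0_norm// mdist_ge0.
have [n [/= h1 h2]] := filter_ex (filterI hy' (small _ e2)).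
have := dist_approx (act (f (u n)) b) y (act (f g) b); rewrite sign_orbit_dist.
have := dist_approx x (act (u n) b) (act g b).
by rewrite !ler_norml => /andP[? ?] /andP[? ?]; apply/andP; split; lra.
Qed.

(* The involution [g.b |-> f(g).b] of the orbit extends to an isometric
   involution of the complete space [X]. *)
Lemma sign_map_act : exists a, forall g, act (a * g)%g b = act (f g) b.
Proof.
have [F hF] := choice extend_at.
have FK : involutive F.
  move=> x; apply: orbit_ext => g.
  by rewrite -{1}(fK g) !hF.
have Forb g : F (act g b) = act (f g) b.
  by apply: mdist_positivity; rewrite hF mdistxx.
have Fiso : Iso (@mdist R X) F.
  split; first by exists F.
  move=> x y; apply/eqP; rewrite -subr_eq0 -normr_eq0 eq_le normr_ge0 andbT.
  apply/ler_addgt0Pr => e e0; rewrite add0r; have e2 : 0 < e / 2 by rewrite divr_gt0.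
  have [g hg] := @orbit_near y _ e2.
  have h1 := dist_approx (F y) (act (f g) b) (F x).
  have h2 := dist_approx y (act g b) x.
  rewrite (metric_sym (F y)) (metric_sym (act (f g) b)) !hF in h1.
  rewrite (metric_sym y x) (metric_sym (act g b)) in h2.
  by move: h1 h2; rewrite !ler_norml => /andP[? ?] /andP[? ?]; apply/andP; split; lra.
move: Fiso; rewrite isoE => -[a _ aF]; exists a => g.
by rewrite actM -Forb -aF.
Qed.

(** The element [a] representing [f] fixes [b], so commutativity gives [x^-1.b = (a * x).b = x.b].
    Hence [x * x] fixes the whole orbit and is [1]. *)
Lemma abelian_inv_involutive : is_abelian [set: G] -> (forall x, f x = x^-1%g) ->
  forall x, f x = x.
Proof.
move=> ab fV x; have [a ha] := sign_map_act.
have ab1 : act a b = b by have := ha 1%g; rewrite sf.1 mulg1 act1.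
have xV : act x b = act x^-1%g b.
  by rewrite -fV -ha (ab a x) ?actM ?ab1.
rewrite fV; apply: invg_sq1; apply: fixes_orbit => g.
by rewrite -actM (ab _ g)// !actM xV -(actM x) mulgV act1.
Qed.

(** Since [p] is central, it suffices that it fixes [b], as the representing element [a] does. If
    [a] is outside [H], then [p = a * a]. Otherwise, for [x] outside [H],
    [(a * x).b = x^-1.b = (x * p).b], and since [x] inverts [a], [p.b = a^-1.b = b]. *)
Lemma exceptional_sign_map_absurd (H : set G) (p : G) :
  (exists g, ~ H g) -> (p * p = 1)%g -> (forall x, p * x = x * p)%g ->
  (forall x, ~ H x -> [/\ (x * x = p)%g, f x = x^-1%g &
     forall y, H y -> (y ^ x = y^-1)%g]) -> p = 1%g.
Proof.
move=> [x Hx] p2 pC hH; have [a ha] := sign_map_act.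
have ab1 : act a b = b by have := ha 1%g; rewrite sf.1 mulg1 act1.
suff pb : act p b = b by apply: fixes_orbit => g; rewrite -actM pC actM pb.
have [Ha|/hH[<- _ _]] := pselect (H a); last by rewrite actM !ab1.
have [xx fx xV] := hH x Hx.
have xp : (x^-1 = x * p)%g by apply: mulg1_eq; rewrite mulgA xx.
have hx := ha x; rewrite fx xp in hx.
have := congr1 (act x^-1%g) hx; rewrite -!actM mulKg -conjgE xV// => <-.
by rewrite -{1}ab1 -actM mulVg act1.
Qed.

End DenseOrbit.

Lemma cond_i_cond_iii (R : realType) (G : topologicalGroupType) :
  cond_i R G -> cond_iii G.
Proof.
move=> [X [act [cX cact eff isoE [b bd]]]]; apply: contrapT => niii.
have [f [sf fK [g fg] cases]] := not_cond_iii niii.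
case: cases => [[ab fV]|[H [p [Hg p1 p2 pC hH]]]].
  exact/fg/(abelian_inv_involutive cX cact eff isoE bd sf fK ab fV).
exact/p1/(exceptional_sign_map_absurd cX cact eff isoE bd sf fK Hg p2 pC hH).
Qed.

Theorem theorem1p3 (R : realType) (G : topologicalGroupType)
    (polishG : polish_space R G) (lcG : locally_compact [set: G]) :
  [/\ cond_i R G <-> cond_ii R G,
      cond_ii R G <-> cond_iii G,
      forall rho : G -> G -> R, left_translation_metric rho ->
        [/\ topgroup_isomorphic (isom rho) G, continuous_action (@isom_fun R G rho),
            free_action (@isom_fun R G rho), transitive_action (@isom_fun R G rho)
          & proper_action (@isom_fun R G rho)]
    & [/\ ~ is_solvable G -> cond_ii R G,
          ~ is_abelian [set: G] ->
            group_center G = [set 1%g] \/ ~ Boolean (group_center G) -> cond_ii R G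
        & ~ is_abelian [set: G] -> connected [set: G] -> cond_ii R G]].
Proof.
have iii_ii := @cond_iii_cond_ii R G polishG lcG.
split.
- split=> [/cond_i_cond_iii/iii_ii//|]; exact: cond_ii_cond_i.
- by split=> [/cond_ii_cond_i/cond_i_cond_iii|/iii_ii].
- move=> rho lt; split.
  + exact: translation_metric_isomorphic.
  + exact: translation_metric_continuous_action.
  + exact: translation_metric_free.
  + exact: translation_metric_transitive.
  + exact: translation_metric_proper_action.
- split=> [/nonsolvable_cond_iii/iii_ii//|nab Z|nab cG].
    exact/iii_ii/center_cond_iii.
  exact/iii_ii/connected_cond_iii.
Qed.
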